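(* Let $(X,d,\mathfrak{m})$ be a locally metrically doubling metric measure space with the following properties: (1) For every $\mu_0\in\mathcal{P}_2^{ac}(X)$ and every $\mu_1\in\mathcal{P}_2(X)$, there exists a unique $\pi\in\mathrm{OptGeo}(\mu_0,\mu_1)$, and it is induced by a map from $\mu_0$. (2) There exists a point $x\in X$ such that $\mathrm{Tan}(X,x)=\{(\mathbb{R},0)\}$. Then $X$ is a one-dimensional manifold, possibly with boundary.
   Context: Standing conventions. A metric measure space $(X,d,\mathfrak{m})$ is a complete, locally compact and separable length space $(X,d)$ (hence geodesic) equipped with a locally finite Borel measure $\mathfrak{m}$ with $\operatorname{spt}\mathfrak{m}=X$. Locally metrically doubling: every point of $X$ has a neighbourhood $U$ for which there are $R>0$ and $C\in\mathbb{N}$ such that every ball $B(y,r)$ with $y\in U$ and $0<r\le R$ can be covered by at most $C$ balls of radius $r/2$. $\mathrm{Geo}(X)$ is the space of constant speed, length minimising geodesics $\gamma:[0,1]\to X$, with the supremum distance; $e_t:\mathrm{Geo}(X)\to X$, $e_t(\gamma)=\gamma_t$. $\mathcal{P}(X)$ is the set of Borel probability measures on $X$; $\mathcal{P}_2(X)$ is the set of those with finite second moment; $\mathcal{P}_2^{ac}(X)$ is the set of $\mu\in\mathcal{P}_2(X)$ absolutely continuous with respect to $\mathfrak{m}$. For $\mu_0,\mu_1\in\mathcal{P}_2(X)$, $\mathrm{Opt}(\mu_0,\mu_1)$ is the set of minimisers of $\int d^2(x,y)\,d\sigma(x,y)$ among all $\sigma\in\mathcal{P}(X\times X)$ with first marginal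 $\mu_0$ and second marginal $\mu_1$, and $\mathrm{OptGeo}(\mu_0,\mu_1)$ is the set of $\pi\in\mathcal{P}(\mathrm{Geo}(X))$ with $(e_0,e_1)_\#\pi\in\mathrm{Opt}(\mu_0,\mu_1)$. A plan $\pi\in\mathrm{OptGeo}(\mu_0,\mu_1)$ is induced by a map (from $\mu_0$) if there is a Borel map $T:X\to\mathrm{Geo}(X)$ with $\pi=T_\#\mu_0$ and $e_0\circ T=\mathrm{id}$. Gromov–Hausdorff tangents. A map $f:(Y,d_Y)\to(Z,d_Z)$ is a $(1,\varepsilon)$-quasi-isometry if $|d_Z(f(y),f(y'))-d_Y(y,y')|\le\varepsilon$ for all $y,y'\in Y$ and the image of $f$ is $\varepsilon$-dense in $Z$. A sequence $(X_i,d_i,x_i)$ of pointed, complete, separable, locally compact geodesic spaces converges to such a space $(X_\infty,d_\infty,x_\infty)$ in the pointed Gromov–Hausdorff sense if for all $R>0$ there are $\varepsilon_i\to0$ and $(1,\varepsilon_i)$-quasi-isometries $f_i:\bar B(x_i,R)\to\bar B(x_\infty,R)$ with $f_i(x_i)=x_\infty$. $\mathrm{Tan}(X,x)$ is the set of (pointed isometry classes of) pointed spaces $(Y,d_Y,y)$ for which there is a sequence $\lambda_i\to\infty$ with $(X,\lambda_i d,x)\to(Y,d_Y,y)$ in this sense. $\mathrm{Tan}(X,x)=\{(\mathbb{R},0)\}$ means that, up to pointed isometry, $(\mathbb{R},|\cdot|,0)$ is the unique element of $\mathrm{Tan}(X,x)$. *)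

(* Defs.v *)
From HB Require Import structures.
From mathcomp Require Import all_boot all_order all_algebra.
From mathcomp Require Import all_classical all_reals all_analysis.

Set Implicit Arguments.
Unset Strict Implicit.
Unset Printing Implicit Defensive.

Import Order.TTheory GRing.Theory Num.Theory.
Import numFieldNormedType.Exports.

Local Open Scope classical_set_scope.
Local Open Scope ring_scope.

(* [CompletePseudoMetric] includes a distinguished element [point], required by
   the library's complete and measurable types.  It only says that the space is
   nonempty: it is never used as a base point, and isometries ignore it. *)
#[short(type="completeMetricType")]
HB.structure Definition CompleteMetric (R : numDomainType) :=
  {T of CompletePseudoMetric R T & Metric R T}.

HB.instance Definition _ (R : realType) := Metric.on R^o.

Notation borel T := (g_sigma_algebraType (open : set (set T))).

Section metric_spaces.
Context {R : realType}.
Implicit Types X Y : metricType R.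

Definition separable X := exists2 D : set X, countable D & dense D.

Definition locally_doubling X := forall x : X, exists2 U, nbhs x U &
  exists (r0 : R) (C : nat), 0 < r0 /\
    forall (y : X) (r : R), U y -> 0 < r <= r0 ->
      exists2 s : seq X, (size s <= C)%N &
        ball y r `<=` \bigcup_(z in [set` s]) ball z (r / 2).

(* Same partitions as in the library's [variation], which is restricted to
   real-valued functions. *)
Definition curve_length X (a b : R) (c : R -> X) : \bar R :=
  ereal_sup [set (let F := c \o nth b (a :: s) in
                  \sum_(0 <= n < size s) mdist (F n) (F n.+1))%:E
            | s in itv_partition a b].

Definition length_space X := forall x y : X,
  (mdist x y)%:E = ereal_inf [set curve_length 0 1 c | c in
    [set c : R -> X | [/\ {within `[0, 1], continuous c}, c 0 = x & c 1 = y]]].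

Definition is_geodesic X (c : {i01 R} -> X) := forall s t : {i01 R},
  mdist (c s) (c t) = `|s%:num - t%:num| * mdist (c 0%:i01) (c 1%:i01).

Record geo X := Geo {
  geo_fun :> {i01 R} -> X ;
  geoP : is_geodesic geo_fun }.

Definition geodesic_space X :=
  forall x y : X, exists g : geo X, g 0%:i01 = x /\ g 1%:i01 = y.

Definition geo_dist X (g h : geo X) : R :=
  sup [set mdist (g t) (h t) | t in [set: {i01 R}]].

Lemma geo_eqP X (g h : geo X) : g =1 h -> g = h.
Proof.
case: g h => [g gP] [h hP] /= /funext gh; subst h.
by congr Geo; exact: Prop_irrelevance.
Qed.

Lemma geo_dist_ub X (g h : geo X) t : mdist (g t) (h t) <= geo_dist g h.
Proof.
apply: ub_le_sup; last by exists t.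
have H (k : geo X) s : mdist (k 0%:i01) (k s) <= mdist (k 0%:i01) (k 1%:i01).
  rewrite (geoP k) ler_piMl ?mdist_ge0//= sub0r normrN ger0_norm//.
exists (mdist (g 0%:i01) (g 1%:i01) + mdist (g 0%:i01) (h 0%:i01)
        + mdist (h 0%:i01) (h 1%:i01)) => _ [s _ <-].
rewrite (le_trans (metric_triangle _ (h 0%:i01) _))// lerD//.
rewrite (le_trans (metric_triangle _ (g 0%:i01) _))// lerD//.
by rewrite metric_sym.
Qed.

Lemma geo_dist_le X (g h : geo X) e :
  (forall t, mdist (g t) (h t) <= e) -> geo_dist g h <= e.
Proof.
move=> H; apply: ge_sup; first by exists (mdist (g 0%:i01) (h 0%:i01)), 0%:i01.
by move=> _ [t _ <-].
Qed.

HB.instance Definition _ X := gen_eqMixin (geo X).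
HB.instance Definition _ X := gen_choiceMixin (geo X).

Lemma geo_distxx X (g : geo X) : geo_dist g g = 0.
Proof.
apply/eqP; rewrite eq_le geo_dist_le/=; last by move=> t; rewrite mdistxx.
by rewrite (le_trans _ (geo_dist_ub g g 0%:i01))// mdist_ge0.
Qed.

Lemma geo_dist_positivity X (g h : geo X) : geo_dist g h = 0 -> g = h.
Proof.
move=> gh; apply/geo_eqP => t; apply/mdist_positivity/eqP.
by rewrite eq_le mdist_ge0 andbT -gh geo_dist_ub.
Qed.

Lemma geo_dist_sym X (g h : geo X) : geo_dist g h = geo_dist h g.
Proof.
by rewrite /geo_dist; under [in LHS]eq_imagel do rewrite metric_sym.
Qed.

Lemma geo_dist_triangle X (h g k : geo X) :
  geo_dist g k <= geo_dist g h + geo_dist h k.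
Proof.
apply: geo_dist_le => t; rewrite (le_trans (metric_triangle _ (h t) _))//.
by rewrite lerD// geo_dist_ub.
Qed.

HB.instance Definition _ X := @isMetric.Build R (geo X) (@geo_dist X)
  (@geo_distxx X) (@geo_dist_positivity X) (@geo_dist_sym X)
  (@geo_dist_triangle X).

Definition geo_ends X (g : geo X) : X * X := (g 0%:i01, g 1%:i01).

Lemma continuous_geo_ends X : continuous (@geo_ends X).
Proof.
have ev t (g : geo X) : h t @[h --> g] --> g t.
  move=> /= A /nbhs_ballP[e /= e0 gA].
  apply: (filterS (P := ball g e)); last exact: nbhsx_ballx.
  move=> h; rewrite ballEmdist/= => gh; apply: gA.
  by rewrite ballEmdist/=; exact: le_lt_trans (geo_dist_ub g h t) gh.
by move=> g; apply: (@cvg_pair _ _ _ (nbhs g) (nbhs (g 0%:i01)) (nbhs (g 1%:i01))); exact: ev.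
Qed.

End metric_spaces.

Section borel_measures.
Context {R : realType} {X : completeMetricType R}.

Lemma is_geodesic_cst : is_geodesic (fun=> point : X).
Proof. by move=> s t; rewrite !mdistxx mulr0. Qed.

HB.instance Definition _ := isPointed.Build (geo X) (Geo is_geodesic_cst).

(* The map (e_0, e_1) *)
Definition endpoints : borel (geo X) -> borel (X * X)%type := @geo_ends R X.

Lemma measurable_endpoints : measurable_fun setT endpoints.
Proof.
apply: (@measurability _ _ _ (borel (X * X)%type) _ _ open) => //.
move=> _ [U oU <-].
rewrite setTI; apply: sub_sigma_algebra; apply: open_comp => // g _.
exact: continuous_geo_ends.
Qed.

HB.instance Definition _ := @isMeasurableFun.Build _ _ _ _ endpoints
  measurable_endpoints.

Implicit Types (m : {measure set (borel X) -> \bar R})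
  (mu : probability (borel X) R) (sigma : probability (borel (X * X)%type) R)
  (p : probability (borel (geo X)) R).

Definition locally_finite_measure m :=
  forall x : X, exists2 U, open_nbhs x U & (m U < +oo)%E.

Definition measure_support m : set X :=
  [set x | forall U, open_nbhs x U -> (0 < m U)%E].

Definition P2 : set (probability (borel X) R) :=
  [set mu : probability (borel X) R | exists x0 : X,
     (\int[mu]_x ((mdist (x : X) x0) ^+ 2)%:E < +oo)%E].

Definition P2ac m : set (probability (borel X) R) :=
  [set mu : probability (borel X) R | P2 mu /\ mu `<< m].

(* A library measure is a function on all subsets, unconstrained outside the
   sigma-algebra, so equality of two measures means equality on Borel sets, not
   Leibniz equality. *)
Definition measure_eq (T : ptopologicalType) (P Q : set (borel T) -> \bar R) :=
  forall A, measurable A -> P A = Q A.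

Definition couplings mu0 mu1 : set (probability (borel (X * X)%type) R) :=
  [set sigma |
     measure_eq (pushforward sigma (fst : borel (X * X)%type -> borel X)) mu0 /\
     measure_eq (pushforward sigma (snd : borel (X * X)%type -> borel X)) mu1].

Definition quadratic_cost sigma : \bar R :=
  (\int[sigma]_z ((mdist (z.1 : X) (z.2 : X)) ^+ 2)%:E)%E.

Definition Opt mu0 mu1 : set (probability (borel (X * X)%type) R) :=
  [set sigma | couplings mu0 mu1 sigma /\
     forall sigma', couplings mu0 mu1 sigma' ->
       (quadratic_cost sigma <= quadratic_cost sigma')%E].

Definition OptGeo mu0 mu1 : set (probability (borel (geo X)) R) :=
  [set p : probability (borel (geo X)) R |
     Opt mu0 mu1 (distribution p endpoints)].

Definition induced_by_map mu0 p := exists T : borel X -> borel (geo X),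
  [/\ measurable_fun setT T,
      measure_eq p (pushforward mu0 T)
    & forall x, (T x : geo X) 0%:i01 = x].

End borel_measures.

Section gromov_hausdorff.
Context {R : realType}.

(* Distances are explicit arguments here, so that the rescaled spaces (X, l d)
   are obtained without changing the metric structure of X. *)
Definition closed_dball (T : Type) (d : T -> T -> R) (x : T) (r : R) : set T :=
  [set y | d x y <= r].

Definition quasi_isometry (T U : Type) (dT : T -> T -> R) (dU : U -> U -> R)
    (A : set T) (B : set U) (e : R) (f : T -> U) :=
  [/\ set_fun A B f,
      forall y y', A y -> A y' -> `|dU (f y) (f y') - dT y y'| <= e
    & forall z, B z -> exists2 y, A y & dU (f y) z <= e].

Definition pGH_cvg (T : nat -> Type) (dT : forall i, T i -> T i -> R)
    (x : forall i, T i) (U : Type) (dU : U -> U -> R) (y : U) :=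
  forall r : R, 0 < r -> exists (e : nat -> R) (f : forall i, T i -> U),
    e @ \oo --> 0 /\
    forall i, quasi_isometry (@dT i) dU
                (closed_dball (@dT i) (x i) r) (closed_dball dU y r) (e i) (f i)
              /\ f i (x i) = y.

Definition in_Tan (X : completeMetricType R) (x : X)
    (Y : completeMetricType R) (y : Y) :=
  [/\ separable Y, locally_compact [set: Y], geodesic_space Y &
    exists l : nat -> R, [/\ forall i, 0 < l i, l @ \oo --> +oo &
      pGH_cvg (T := fun=> X) (fun i a b => l i * mdist a b) (fun=> x)
        (@mdist R Y) y]].

Definition pointed_isometric (X Y : metricType R) (x : X) (y : Y) :=
  exists f : X -> Y,
    [/\ bijective f, forall a b, mdist (f a) (f b) = mdist a b & f x = y].

(* Tan(X, x) = {(R, 0)}, where the metric space R is [R^o]. *)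
Definition Tan_eq_line (X : completeMetricType R) (x : X) :=
  in_Tan x (0 : R^o) /\
  forall (Y : completeMetricType R) (y : Y),
    in_Tan x y -> pointed_isometric y (0 : R^o).

End gromov_hausdorff.

(* Topological manifold: charts take values in relatively open subsets of the
   half-line [0, +oo[. *)
Definition one_manifold_with_boundary (R : realType) (X : topologicalType) :=
  [/\ hausdorff_space X, @second_countable X &
    forall x : X, exists U : set X, open_nbhs x U /\
      exists (W : set R) (f : X -> R) (g : R -> X),
        let V := W `&` `[0, +oo[ in
        open W /\
        [/\ set_fun U V f, set_fun V U g, {in U, cancel f g}, {in V, cancel g f}
          & {within U, continuous f} /\ {within V, continuous g}]].

(* Main.v *)
(* In a space like the one of the theorem, call z a funnel point if there are
   c <> z and a nonempty open set A such that d(a, p) = d(a, c) + d(c, p) for all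
   a in A and all p near z.  If two such points p, q were at the same distance
   from c, they would be equidistant from every point of A, so all couplings of
   the normalised restriction of m to A with (delta_p + delta_q) / 2 would be
   optimal; the half-sum of optimal plans to delta_p and to delta_q is then an
   optimal plan that is not induced by a map, a contradiction.  Hence d(., c) is
   injective near a funnel point; as X is a locally compact length space it is
   even an isometry onto an interval, which gives a chart.

   It remains to find funnel points.  By Gromov compactness (doubling, and an
   ultralimit of rescalings of X) uniqueness of the tangent forces X to be close
   to a line at all small scales around x.  A geodesic joining the two sides of x
   that passes at distance rho > 0 from x also joins the two sides at the scale
   10 rho, so it comes within rho / 2 of x; therefore it passes through x.  This
   makes x the neck c of a funnel and yields an open ball isometric to an interval.
   Finally every geodesic that leaves this ball crosses one of two of its points,
   so that every point of X is a funnel point. *)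
From HB Require Import structures.
Require Import Defs.
From mathcomp Require Import all_boot all_order all_algebra.
From mathcomp Require Import all_classical all_reals all_analysis.
From mathcomp Require Import measurable_realfun ring lra.

Set Implicit Arguments.
Unset Strict Implicit.
Unset Printing Implicit Defensive.

Import Order.TTheory GRing.Theory Num.Theory.
Import numFieldNormedType.Exports.

Local Open Scope classical_set_scope.
Local Open Scope ring_scope.

(** * Metric spaces and length spaces *)

Section metric_facts.
Context {R : realType}.
Implicit Type X : metricType R.

Lemma exists_invS_lt (e : R) : 0 < e -> exists n : nat, n.+1%:R^-1 < e.
Proof.
move=> e0; have [N _ /(_ N (leqnn _)) H] := near_infty_natSinv_lt (PosNum e0).
by exists N.
Qed.

Lemma nbhs_mdist_exP X (x : X) (A : set X) :
  nbhs x A <-> exists2 e : R, 0 < e & forall y, mdist x y < e -> A y.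
Proof.
split=> [/nbhs_ballP[e /= e0 xA]|[e e0 xA]].
  by exists e => // y xy; apply: xA; rewrite ballEmdist.
by apply/nbhs_ballP; exists e => //= y; rewrite ballEmdist => /xA.
Qed.

Lemma open_mdist_ball X (x : X) (e : R) : open [set y | mdist x y < e].
Proof.
rewrite openE => y /= xy; apply/nbhs_mdist_exP; exists (e - mdist x y).
  by rewrite subr_gt0.
move=> z yz /=; have := metric_triangle x y z; lra.
Qed.

Lemma mdist_lip X (x y z : X) : `|mdist x y - mdist x z| <= mdist y z.
Proof.
have := metric_triangle x y z; have := metric_triangle x z y.
rewrite (metric_sym z y) ler_norml; move=> ? ?; apply/andP; split; lra.
Qed.

Lemma mdist_continuous X (x : X) : continuous (mdist x : X -> R).
Proof.
move=> y; apply/cvgrPdist_le => e e0; apply/nbhs_mdist_exP; exists e => // z yz.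
exact: le_trans (mdist_lip x y z) (ltW yz).
Qed.

Lemma second_countable_separable X : separable X -> @second_countable X.
Proof.
move=> [D cD dD].
exists [set [set y : X | mdist u.1 y < u.2.+1%:R^-1] | u in D `*` [set: nat]].
  apply: (sub_countable (card_image_le _ _)); exact: countableX.
split=> [_ [[x n] _ <-]|x A /nbhs_mdist_exP[e e0 xA]].
  exact: open_mdist_ball.
have [n ne] := exists_invS_lt (ltac:(lra) : 0 < e / 2).
have n0 : 0 < n.+1%:R^-1 :> R by rewrite invr_gt0.
pose k : R := n.+1%:R^-1; rewrite -/k in ne n0.
have [||y [/= xy Dy]] := dD [set y | mdist x y < k].
- by exists x; rewrite /= mdistxx.
- exact: open_mdist_ball.
exists [set z | mdist y z < k] => /=.
  by split; [exists (y, n) | rewrite /= metric_sym].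
by move=> z /= yz; apply: xA; have := metric_triangle x y z; lra.
Qed.

(** The chart clause of [one_manifold_with_boundary] at a single point. *)
Definition half_line_chart X (x : X) := exists U : set X, open_nbhs x U /\
      exists (W : set R) (f : X -> R) (g : R -> X),
        let V := W `&` `[0, +oo[ in
        open W /\
        [/\ set_fun U V f, set_fun V U g, {in U, cancel f g}, {in V, cancel g f}
          & {within U, continuous f} /\ {within V, continuous g}].

Lemma chart_of_isometry X (U : set X) (W : set R) (f : X -> R) x :
  open_nbhs x U -> open W -> f @` U = W `&` `[0, +oo[ ->
  (forall p q, U p -> U q -> mdist p q = `|f p - f q|) ->
  half_line_chart x.
Proof.
move=> oU oW fUW fi; exists U; split=> //; exists W, f.
(* The inverse chart is chosen pointwise; outside the image it takes the dummy value [x]. *)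
have /choice[g gP] : forall v, exists p, (W `&` `[0, +oo[) v -> U p /\ f p = v.
  move=> v; have [|nv] := pselect ((W `&` `[0, +oo[) v); last by exists x.
  by rewrite -fUW => -[p Up <-]; exists p.
exists g => /=; split=> //.
have fV p : U p -> (W `&` `[0, +oo[) (f p) by move=> Up; rewrite -fUW; exists p.
split=> //.
- by move=> v /gP[].
- move=> p; rewrite inE => Up; apply: mdist_positivity.
  have [Ug fg] := gP _ (fV _ Up).
  by rewrite fi// fg subrr normr0.
- by move=> v; rewrite inE => /gP[].
split; apply/subspace_continuousP.
  move=> p Up; apply/cvgrPdist_le => e e0; rewrite near_withinE.
  by apply/nbhs_mdist_exP; exists e => // q pq Uq; rewrite -fi// ltW.
move=> v Vv; apply/metricType_numDomainType.cvgrPdist_le => e e0; rewrite near_withinE.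
apply/nbhs_ballP; exists e => //= w; rewrite /ball/= => vw Vw.
have [Uv fv] := gP _ Vv; have [Uw fw] := gP _ Vw.
by rewrite fi// fv fw ltW.
Qed.

(** An almost shortest curve from [a] to [z] meets the level [v] of [h] by the intermediate value
    theorem, and its length bounds the sum of the two distances from above. *)
Lemma length_space_cross X (a z : X) (h : X -> R) (v e : R) :
  length_space X -> continuous h -> h a <= v <= h z -> 0 < e ->
  exists w, h w = v /\ mdist a w + mdist w z <= mdist a z + e.
Proof.
move=> lX ch /andP[av vz] e0.
have [|_ [c [cc c0 c1] <-]] := @lb_ereal_inf_adherent R [set curve_length 0 1 c | c in
    [set c : R -> X | [/\ {within `[0, 1], continuous c}, c 0 = a & c 1 = z]]] e e0.
  by rewrite -lX.
rewrite -lX -EFinD => clt.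
have [||t t01 ct] := @IVT R (h \o c) 0 1 v ler01.
- by move=> s; apply: (@continuous_comp (subspace _) _ _ c h); [exact: cc|exact: ch].
- by rewrite /= c0 c1 ge_min av/= le_max vz orbT.
exists (c t); split=> //.
(* Partitions are strictly increasing, so [[:: t; 1]] requires [0 < t < 1]; the two end parameters
   are treated apart. *)
move: t01; rewrite in_itv/= => /andP[]; rewrite le_eqVlt => /predU1P[<- _|t0].
  by rewrite c0 mdistxx add0r lerDl ltW.
rewrite le_eqVlt => /predU1P[->|t1].
  by rewrite c1 mdistxx addr0 lerDl ltW.
rewrite -lee_fin; apply: le_trans (ltW clt).
apply: ereal_sup_ubound; exists [:: t; 1] => /=.
  by split; rewrite /= ?t0 ?t1.
by rewrite big_nat_recr//= big_nat1 /= c0 c1.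
Qed.

(** Approximate intermediate points come from [length_space_cross]. They lie on the sphere of radius
    [t] around [p], compact for [p] near [z] and [t] small, so the distance to [y] attains its
    minimum there and the error disappears. The point [y] may be far from [z]. *)
Lemma length_space_between X (z : X) : length_space X ->
  locally_compact [set: X] ->
  exists2 r : R, 0 < r & forall p y (t : R), mdist z p < r -> 0 <= t <= r ->
    t <= mdist p y -> exists w, mdist p w = t /\ mdist w y = mdist p y - t.
Proof.
move=> lX /(_ z I); rewrite withinET => -[K zK [cK _]].
have [r r0 rK] := (nbhs_mdist_exP _ _).1 zK.
exists (r / 4) => [|p y t zp /andP[t0 tr] tpy]; first lra.
pose S := [set w | mdist p w = t].
have cS : compact S.
  apply: subclosed_compact cK _.
    rewrite (_ : S = mdist p @^-1` [set x | x = t])//; apply: closed_comp => //.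
    by move=> w _; exact: mdist_continuous.
  by rewrite /S => w /= Sw; apply: rK; have := metric_triangle z p w; lra.
have H e : 0 < e -> exists2 w, S w & mdist w y <= mdist p y - t + e.
  move=> e0; have [||w [pw wy]] := @length_space_cross X p y (mdist p) t e lX _ _ e0.
  - exact: mdist_continuous.
  - by rewrite mdistxx t0 tpy.
  by exists w => //; lra.
have [||w Sw wmin] := @compact_EVT_min _ _ (mdist y) S _ cS.
- by have [w Sw _] := H 1 ltr01; exists w.
- by apply: continuous_subspaceT => w; exact: mdist_continuous.
rewrite inE in Sw; exists w; split=> //.
apply/eqP; rewrite eq_le; apply/andP; split; last first.
  by have := metric_triangle p w y; rewrite /S/= in Sw; lra.
apply/ler_addgt0Pr => e /H[v Sv vy]; apply: le_trans vy.
by rewrite metric_sym (metric_sym v); apply: wmin; rewrite inE.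
Qed.

(* [x |-> mdist x c] is a coordinate near [z]: injectivity identifies every
   point at the right distance with the one that lies between. *)
Lemma radial_coordinate X (z c : X) (U : set X) : length_space X ->
  locally_compact [set: X] -> nbhs z U -> z != c ->
  (forall p q, U p -> U q -> mdist p c = mdist q c -> p = q) ->
  exists2 d : R, 0 < d < mdist z c & 
    (forall p q, mdist z p < d -> mdist z q < d ->
      mdist p q = `|mdist p c - mdist q c|) /\
    (forall p (t : R), mdist z p < d -> mdist z c - d < t <= mdist p c ->
      exists2 q, mdist z q < d & mdist q c = t).
Proof.
move=> lX cX /nbhs_mdist_exP[e e0 eU] zc inj.
have [r r0 rP] := length_space_between z lX cX.
have zc0 : 0 < mdist z c by rewrite mdist_gt0.
have [d [d0 de dr dzc]] : exists d : R, [/\ 0 < d, 10 * d < e, 10 * d < r & 10 * d < mdist z c].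
  exists (Num.min (Num.min e r) (mdist z c) / 11).
  have m0 : 0 < Num.min (Num.min e r) (mdist z c) by rewrite !lt_min e0 r0.
  have : Num.min (Num.min e r) (mdist z c) <= mdist z c by rewrite ge_min lexx orbT.
  have : Num.min (Num.min e r) (mdist z c) <= e by rewrite !ge_min lexx.
  have : Num.min (Num.min e r) (mdist z c) <= r by rewrite !ge_min lexx orbT.
  by move=> ? ? ?; split; lra.
exists d; first by apply/andP; split; lra.
(* The point [w] on the way from [p] to [c] with the same distance to [c] as [q] must be [q]. *)
have wl p q : mdist z p < 3 * d -> mdist z q < 3 * d -> mdist q c <= mdist p c ->
    mdist p q = mdist p c - mdist q c.
  move=> zp zq qp; have pq : mdist p q < 6 * d.
    by have := metric_triangle p z q; rewrite (metric_sym p z); lra.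
  have pqc := metric_triangle p q c; have q0 := mdist_ge0 q c.
  have [|||w [pw wc]] := rP p c (mdist p c - mdist q c); try lra.
  suff wq : w = q by rewrite -{1}wq.
  apply: inj; last lra.
    by apply: eU; have := metric_triangle z p w; lra.
  by apply: eU; lra.
have iso p q : mdist z p < 3 * d -> mdist z q < 3 * d ->
    mdist p q = `|mdist p c - mdist q c|.
  move=> zp zq; have [pq|qp] := leP (mdist p c) (mdist q c).
    by rewrite (metric_sym p q) (wl q p)// distrC ger0_norm// subr_ge0.
  by rewrite (wl p q)// ?ltW// ger0_norm// subr_ge0 ltW.
split=> [p q zp zq|p t zp /andP[t1 t2]]; first by apply: iso; lra.
have zz : mdist z z < 3 * d by rewrite mdistxx; lra.
(* Below the level of [z] the point is found on the way from [z] to [c], above it on the way from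
   [p]; either way it stays within [d] of [z]. *)
have [tz|zt] := leP t (mdist z c).
  have [|||w [zw wc]] := rP z c (mdist z c - t); try lra.
  by exists w; lra.
have zpE := iso _ _ zz (lt_trans zp (ltac:(lra) : d < 3 * d)).
rewrite ltr0_norm in zpE; last lra.
have [|||w [pw wc]] := rP p c (mdist p c - t); try lra.
have zw : mdist z w < 3 * d by have := metric_triangle z p w; lra.
exists w; last lra.
by rewrite iso// ltr0_norm; lra.
Qed.

(** Two cases: if some point near [z] is farther from [c] than [z] is, then [z] is an interior
    point; otherwise the coordinate is maximal at [z], which becomes a boundary point. *)
Lemma radial_chart X (z c : X) (d : R) : 0 < d ->
    (forall p q, mdist z p < d -> mdist z q < d ->
      mdist p q = `|mdist p c - mdist q c|) ->
    (forall p (t : R), mdist z p < d -> mdist z c - d < t <= mdist p c ->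
      exists2 q, mdist z q < d & mdist q c = t) ->
  half_line_chart z.
Proof.
move=> d0 iso onto.
have zz : mdist z z < d by rewrite mdistxx.
have [[p zp pz]|np] := pselect (exists2 p, mdist z p < d & mdist z c < mdist p c).
  (* All levels up to [mdist p c] are attained, hence a symmetric interval of radius [k] around that
     of [z]; adding [k] moves it into the open half-line. *)
  have [k [k0 kd kE]] : exists k : R, [/\ 0 < k, k < d & mdist p c = k + mdist z c].
    exists (mdist p c - mdist z c); have := iso _ _ zp zz.
    by rewrite gtr0_norm ?subr_gt0// (metric_sym p z) => ?; split; lra.
  apply: (@chart_of_isometry X [set q | mdist z q < k] [set t | 0 < t < 2 * k]
    (fun q => mdist q c - mdist z c + k)).
  - split; [exact: open_mdist_ball|by rewrite /= mdistxx].
  - rewrite (_ : [set _ | _] = `]0, 2 * k[%classic)//.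
  - apply/seteqP; split=> [_ [q /= zq <-]|t [/= /andP[t0 tk] _]].
      have := iso _ _ zz (lt_trans zq kd); move: zq => /[swap] ->.
      rewrite distrC ltr_norml => /andP[? ?]; split=> /=; first by apply/andP; split; lra.
      by rewrite in_itv/= andbT; lra.
    have [|q zq qc] := onto p (t - k + mdist z c) zp.
      by rewrite kE; apply/andP; split; lra.
    exists q => /=; last lra.
    by rewrite (iso _ _ zz zq) qc ltr_norml; apply/andP; split; lra.
  - move=> u v /= zu zv; rewrite iso; try lra.
    by congr (`|_|); ring.
(* Here no nearby point is farther from [c], so [z] goes to the end 0 of the half-line. *)
apply: (@chart_of_isometry X [set q | mdist z q < d] [set t | - d < t < d]
    (fun q => mdist z c - mdist q c)).
- split; [exact: open_mdist_ball|by by rewrite /= mdistxx].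
- rewrite (_ : [set _ | _] = `]- d, d[%classic)//.
- apply/seteqP; split=> [_ [q /= zq <-]|t [/= /andP[t0 td]]].
    have qz : mdist q c <= mdist z c by rewrite leNgt; apply/negP => ?; apply: np; exists q.
    move: (zq); rewrite iso// ltr_norml => /andP[? ?]; split=> /=; first by apply/andP; split; lra.
    by rewrite in_itv/= andbT; lra.
  rewrite in_itv/= andbT => t1.
  have [|q zq qc] := onto z (mdist z c - t) zz; first by apply/andP; split; lra.
  by exists q => //=; lra.
- move=> u v /= zu zv; rewrite iso//.
  by rewrite distrC; congr (`|_|); ring.
Qed.
End metric_facts.

(** * Funnels and spaces that look like a line *)

Section one_dimensional_geometry.
Context {R : realType}.
Implicit Type X : metricType R.

Definition funnel X (z : X) := exists c (A U : set X),
  [/\ z != c, open A, A !=set0, nbhs z U &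
    forall a p, A a -> U p -> mdist a p = mdist a c + mdist c p].

Definition interval_ball X (z : X) (d : R) (psi : X -> R) := [/\ psi z = 0,
  forall p q, mdist z p < d -> mdist z q < d -> mdist p q = `|psi p - psi q| &
  forall s, `|s| < d -> exists2 p, mdist z p < d & psi p = s].

(** This reflection lets the next two lemmas treat only one side of the ball. *)
Lemma interval_ballN X (z : X) (d : R) psi :
  interval_ball z d psi -> interval_ball z d (fun p => - psi p).
Proof.
move=> [z0 iso onto]; split=> [|p q zp zq|s sd].
- by rewrite z0 oppr0.
- by rewrite iso// -opprD normrN.
- have [|p zp ps] := onto (- s); first by rewrite normrN.
  by exists p => //; rewrite ps opprK.
Qed.

(** The neck is the point of coordinate [- k] and the set [A] a ball around coordinate [- 4 k]:
    points near [z] have coordinate above [- k], so the neck lies between in the interval. *)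
Lemma interval_ball_funnel_nonneg X (z0 z : X) (k : R) psi : 0 < k ->
  interval_ball z0 (8 * k) psi -> mdist z0 z <= 4 * k -> 0 <= psi z -> funnel z.
Proof.
move=> k0 [psi0 iso onto] zk pz.
have z00 : mdist z0 z0 < 8 * k by rewrite mdistxx; lra.
have z0E p : mdist z0 p < 8 * k -> mdist z0 p = `|psi p|.
  by move=> zp; rewrite iso// psi0 sub0r normrN.
have [|c z0c pc] := onto (- k); first by rewrite normrN gtr0_norm; lra.
have [|a0 z0a pa0] := onto (- (4 * k)); first by rewrite normrN gtr0_norm; lra.
have z0a4 : mdist z0 a0 = 4 * k by rewrite z0E// pa0 normrN gtr0_norm; lra.
exists c, [set a | mdist a0 a < k], [set p | mdist z p < k]; split.
- by apply/eqP => zc; move: pz; rewrite zc pc; lra.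
- exact: open_mdist_ball.
- by exists a0; rewrite /= mdistxx.
- by apply/nbhs_mdist_exP; exists k.
- move=> a p /= aa zp.
  have z0a' : mdist z0 a < 8 * k by have := metric_triangle z0 a0 a; lra.
  have z0p' : mdist z0 p < 8 * k by have := metric_triangle z0 z p; lra.
  have z08 : mdist z0 z < 8 * k by lra.
  move: aa zp; rewrite (iso a0 a)// (iso z p)// (iso a p)// (iso a c)// (iso c p)//.
  rewrite pa0 pc !ltr_norml => /andP[? ?] /andP[? ?].
  by rewrite !ler0_norm; lra.
Qed.

(** The sphere of radius [4 * k] around [z0] consists of [L] and [r] only, and almost shortest
    curves to points near [z] cross it. Starting near coordinate [- 2 k], the way through [L] is the
    cheaper one, so [L] is the neck. *)
Lemma interval_ball_funnel_far X (z0 z : X) (k : R) psi L r : length_space X ->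
  0 < k -> interval_ball z0 (8 * k) psi -> 4 * k < mdist z0 z ->
  mdist z0 L < 8 * k -> psi L = - (4 * k) ->
  mdist z0 r < 8 * k -> psi r = 4 * k ->
  mdist L z <= mdist r z -> funnel z.
Proof.
move=> lX k0 [psi0 iso onto] zk z0L pL z0r pr Lr.
have z00 : mdist z0 z0 < 8 * k by rewrite mdistxx; lra.
have z0E p : mdist z0 p < 8 * k -> mdist z0 p = `|psi p|.
  by move=> zp; rewrite iso// psi0 sub0r normrN.
have z0L4 : mdist z0 L = 4 * k by rewrite z0E// pL normrN gtr0_norm; lra.
have [|a0 z0a pa0] := onto (- (2 * k)); first by rewrite normrN gtr0_norm; lra.
have z0a2 : mdist z0 a0 = 2 * k by rewrite z0E// pa0 normrN gtr0_norm; lra.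
(* The last bound keeps points within [h] of [z] outside the ball of radius [4 * k]; the bound by
   [k / 2] makes an error [2 * h] smaller than the gap between [3 * k] and [5 * k]. *)
have [h [h0 hk hz]] : exists h : R, [/\ 0 < h, h <= k / 2 & h <= mdist z0 z - 4 * k].
  exists (Num.min (k / 2) (mdist z0 z - 4 * k)).
  rewrite lt_min; split; [apply/andP; split; lra| |]; rewrite ge_min lexx ?orbT//.
exists L, [set a | mdist a0 a < k], [set p | mdist z p < h]; split.
- by apply/eqP => zL; move: zk; rewrite zL; lra.
- exact: open_mdist_ball.
- by exists a0; rewrite /= mdistxx.
- by apply/nbhs_mdist_exP; exists h.
move=> a p /= aa zp.
have z0a3 : mdist z0 a < 3 * k by have := metric_triangle z0 a0 a; lra.
have z0a8 : mdist z0 a < 8 * k by lra.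
have z0p : 4 * k <= mdist z0 p.
  by have := metric_triangle z0 p z; rewrite (metric_sym p z); lra.
have aL : mdist a L < 3 * k.
  move: aa; rewrite (iso a0 a)// (iso a L)// pa0 pL ltr_norml => /andP[? ?].
  by rewrite ltr_norml; apply/andP; split; lra.
have ar : 5 * k < mdist a r.
  move: aa; rewrite (iso a0 a)// (iso a r)// pa0 pr ltr_norml => /andP[? ?].
  by rewrite ler0_norm; lra.
apply/eqP; rewrite eq_le metric_triangle/=; apply/ler_addgt0Pr => e e0.
have [||w [z0w awp]] := @length_space_cross R X a p (mdist z0) (4 * k) e lX _ _ e0.
- exact: mdist_continuous.
- by apply/andP; split; lra.
have z0w8 : mdist z0 w < 8 * k by lra.
have [wL|wr] : w = L \/ w = r.
- have /eqP := z0w; rewrite z0E// eqr_norml => /andP[/orP[]/eqP pw _]; [right|left];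
  by apply: mdist_positivity; rewrite iso// pw ?pr ?pL subrr normr0.
- by rewrite -wL.
(* Replacing [r] by [L] gains more than [2 * k] on the side of [a] and loses at most [2 * h] on the
   side of [p]. *)
rewrite wr in awp.
have := metric_triangle L z p; have := metric_triangle r p z; rewrite (metric_sym p z).
lra.
Qed.

Lemma interval_ball_funnel X (z0 z : X) (d : R) psi : length_space X -> 0 < d ->
  interval_ball z0 d psi -> funnel z.
Proof.
move=> lX; pose k := d / 8; have -> : d = 8 * k by rewrite /k; lra.
clearbody k => k8 I; have k0 : 0 < k by lra.
have IN := interval_ballN I.
have [zk|zk] := leP (mdist z0 z) (4 * k).
  have [pz|pz] := leP 0 (psi z); first exact: (interval_ball_funnel_nonneg k0 I).
  by apply: (interval_ball_funnel_nonneg k0 IN) => //; rewrite oppr_ge0 ltW.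
have [_ _ onto] := I.
have [|L z0L pL] := onto (- (4 * k)); first by rewrite normrN gtr0_norm; lra.
have [|r z0r pr] := onto (4 * k); first by rewrite gtr0_norm; lra.
have [Lr|rL] := leP (mdist L z) (mdist r z).
  exact: (interval_ball_funnel_far lX k0 I zk z0L pL z0r pr).
apply: (interval_ball_funnel_far lX k0 IN zk z0r _ z0L _ (ltW rL)).
  by rewrite pr.
by rewrite pL opprK.
Qed.

(** Since [z] may be an end of the coordinate interval, the centre is moved by [d / 2] towards
    [c]. *)
Lemma interval_ball_of_coordinate X (z c : X) (d : R) : 0 < d ->
    (forall p q, mdist z p < d -> mdist z q < d ->
      mdist p q = `|mdist p c - mdist q c|) ->
    (forall p (t : R), mdist z p < d -> mdist z c - d < t <= mdist p c ->
      exists2 q, mdist z q < d & mdist q c = t) ->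
  exists (z0 : X) psi, interval_ball z0 (d / 2) psi.
Proof.
move=> d0 iso onto; have zz : mdist z z < d by rewrite mdistxx.
have [|z0 zz0 z0c] := onto z (mdist z c - d / 2) zz; first by apply/andP; split; lra.
have zz0E : mdist z z0 = d / 2 by rewrite iso// z0c gtr0_norm; lra.
have sub p : mdist z0 p < d / 2 -> mdist z p < d.
  by have := metric_triangle z z0 p; lra.
exists z0, (fun p => mdist p c - mdist z0 c); split=> [|p q zp zq|s sd].
- by rewrite subrr.
- by rewrite iso ?sub//; congr (`|_|); ring.
- move: (sd); rewrite ltr_norml => /andP[? ?].
  have [|q zq qc] := onto z (mdist z0 c + s) zz; first by apply/andP; split; lra.
  exists q; last by rewrite qc; ring.
  by rewrite iso// qc (_ : _ - _ = - s) ?normrN//; ring.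
Qed.

(** Gromov-Hausdorff closeness of one ball to a segment; the error is proportional to [r], which
    makes the condition invariant under rescaling. *)
Definition line_like X (x : X) (e r : R) := exists f : X -> R, [/\ f x = 0,
  forall p q, mdist x p <= r -> mdist x q <= r ->
    `| `|f p - f q| - mdist p q| <= e * r &
  forall s, `|s| <= r -> exists2 p, mdist x p <= r & `|f p - s| <= e * r].

Definition unit_speed X (D : R) (c : R -> X) := forall s t,
  0 <= s <= D -> 0 <= t <= D -> mdist (c s) (c t) = `|s - t|.

Lemma geo_unit_speed X (g : geo X) : exists (D : R) (c : R -> X),
  [/\ 0 <= D, unit_speed D c, c 0 = g 0%:i01 & c D = g 1%:i01].
Proof.
have [D DE] : exists D : R, D = mdist (g 0%:i01) (g 1%:i01) by eexists.
exists D; have [D0|D0] := eqVneq D 0.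
  exists (fun=> g 0%:i01); split=> //; [by rewrite D0| |by apply: mdist_positivity; rewrite -DE].
  move=> s t; rewrite D0 => /le_anti <- /le_anti <-.
  by rewrite subrr normr0 mdistxx.
have Dp : 0 < D by rewrite lt_neqAle eq_sym D0 DE mdist_ge0.
have /choice[u uE] : forall s : R, exists u : {i01 R}, 0 <= s <= D -> u%:num = s / D.
  move=> s; have [/andP[s0 sD]|sD] := pselect (0 <= s <= D); last by exists 0%:i01.
  have s1 : 0 <= s / D by rewrite divr_ge0// ltW.
  have s2 : s / D <= 1 by rewrite ler_pdivrMr// mul1r.
  by exists (Itv01 s1 s2).
have D00 : 0 <= (0 : R) <= D by rewrite lexx ltW.
have DD : 0 <= D <= D by rewrite lexx ltW.
exists (g \o u); split=> /=; first exact: ltW.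
- move=> s t sD tD; rewrite /= (geoP g) -DE !uE// -mulrBl normrM -mulrA.
  by rewrite normfV (gtr0_norm Dp) mulVf// mulr1.
- by congr (geo_fun g _); apply/val_inj; rewrite /= uE// mul0r.
- by congr (geo_fun g _); apply/val_inj; rewrite /= uE// divff.
Qed.

(** The bound on [|v|] puts [v] on the same side of [u] as 0. Being at distance about [|u|] from
    [u], the point [s] is near 0 or near [2 * u], and the latter is too far from [v]. *)
Lemma line_middle (u v s D e : R) : `| `|u - v| - D| <= e ->
  `| `|u - s| - `|u| | <= e -> `| `|v - s| - (D - `|u|)| <= e ->
  `|v| + e < `|u| + D -> 2 * e < `|u| -> `|s| <= e.
Proof.
wlog u0 : u v s / 0 <= u => [H|].
  have [u0|u0] := leP 0 u; first exact: H.
  have := H (- u) (- v) (- s).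
  by rewrite -!opprD !normrN oppr_ge0; apply; exact: ltW.
rewrite !(ler_norml _ e) (ger0_norm u0) => /andP[+ +] /andP[+ +] /andP[+ +].
case: (ger0P (u - v)) => ?; case: (ger0P (u - s)) => ?; case: (ger0P (v - s)) => ?;
case: (ger0P v) => ? *; apply/andP; split; lra.
Qed.

Lemma line_like_norm X (x : X) (f : X -> R) (e r : R) p : f x = 0 -> 0 <= r ->
  (forall p q, mdist x p <= r -> mdist x q <= r ->
    `| `|f p - f q| - mdist p q| <= e) ->
  mdist x p <= r -> `| `|f p| - mdist x p| <= e.
Proof.
move=> fx r0 H xp; have := H _ _ xp; move=> /(_ x); rewrite mdistxx => /(_ r0).
by rewrite fx subr0 metric_sym.
Qed.

(* Near [x] the curve is long compared with its distance [rho] to [x], so at the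
   scale [10 * rho] it runs from one side of the line to the other; the point
   that is as far from one end as [x] is must then be close to [x]. *)
Lemma unit_speed_halving X (x : X) (c : R -> X) (D r0 t rho : R) :
  (forall r, 0 < r < r0 -> line_like x (1000^-1) r) ->
  unit_speed D c -> 0 <= t <= D -> 0 < rho -> mdist x (c t) <= rho ->
  6 * rho <= mdist x (c 0) -> 6 * rho <= mdist x (c D) -> 10 * rho < r0 ->
  exists2 s, 0 <= s <= D & mdist x (c s) <= rho / 2.
Proof.
move=> line uc /andP[t0 tD] rho0 xt x0 xD rr.
have D0 : 0 <= D := le_trans t0 tD.
have ucE s s' : 0 <= s -> s <= s' -> s' <= D -> mdist (c s) (c s') = s' - s.
  move=> s0 ss sD; rewrite uc; last by rewrite sD (le_trans s0).
    by rewrite distrC ger0_norm// subr_ge0.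
  by rewrite s0 (le_trans ss).
have t5 : 5 * rho <= t.
  by have := ucE 0 t (lexx _) t0 tD; have := metric_triangle x (c t) (c 0);
     rewrite (metric_sym (c t) (c 0)); lra.
have t5D : 5 * rho <= D - t.
  by have := ucE t D t0 tD (lexx _); have := metric_triangle x (c t) (c D); lra.
have [|f [fx fi _]] := line (10 * rho); first by apply/andP; split; lra.
have eE : 1000^-1 * (10 * rho) = rho / 100 by lra.
rewrite eE in fi.
move: (rho / 100) eE fi => e eE0 fi; have {eE0}eE : e = rho / 100 by lra.
have r10 : 0 <= 10 * rho by lra.
have fn := line_like_norm fx r10 fi.
(* The ends of the curve are at least [6 * rho] from [x], so it extends by [5 * rho] on both sides
   of [t]; the points reached stay within [6 * rho] of [x]. *)
have tm : mdist (c (t - 5 * rho)) (c t) = 5 * rho by rewrite ucE; move: rho0 t5 t5D t0 tD; clear; lra.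
have tp : mdist (c t) (c (t + 5 * rho)) = 5 * rho by rewrite ucE; move: rho0 t5 t5D t0 tD; clear; lra.
have tmp : mdist (c (t - 5 * rho)) (c (t + 5 * rho)) = 10 * rho by rewrite ucE; move: rho0 t5 t5D t0 tD; clear; lra.
move: {-2}(c (t - 5 * rho)) (erefl (c (t - 5 * rho))) tm tmp => a aE tm tmp.
move: {-2}(c (t + 5 * rho)) (erefl (c (t + 5 * rho))) tp tmp => b bE tp tmp.
have xa : mdist x a <= 6 * rho.
  by have := metric_triangle x (c t) a; rewrite (metric_sym (c t)); lra.
have xa' : 4 * rho <= mdist x a.
  by have := metric_triangle a x (c t); rewrite (metric_sym a x); lra.
have xb : mdist x b <= 6 * rho by have := metric_triangle x (c t) b; lra.
have xa10 : mdist x a <= 10 * rho by move: xa rho0; clear; lra.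
have /fn := xa10.
rewrite ler_norml => /andP[fa1 fa2].
have xb10 : mdist x b <= 10 * rho by move: xb rho0; clear; lra.
have /fn := xb10.
rewrite ler_norml => /andP[fb1 fb2].
(* [h] is the distance from [f a] to 0; the point of the curve at arc distance [h] after [a] is the
   one close to [x]. *)
move: {-2}`|f a| (erefl `|f a|) fa1 fa2 => h hE fa1 fa2.
have h3 : 3 * rho <= h by move: fa1 xa' eE rho0; clear; lra.
have h7 : h <= 7 * rho by move: fa2 xa eE rho0; clear; lra.
have aw : mdist a (c (t - 5 * rho + h)) = h by rewrite aE ucE; move: rho0 t5 t5D h3 h7; clear; lra.
have wb : mdist (c (t - 5 * rho + h)) b = 10 * rho - h by rewrite bE ucE; move: rho0 t5 t5D h3 h7; clear; lra.
move: {-2}(c (t - 5 * rho + h)) (erefl (c (t - 5 * rho + h))) aw wb => w wE aw wb.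
have xw : mdist x w <= 10 * rho.
  have [h5|h5] := leP h (5 * rho).
    have : mdist w (c t) = 5 * rho - h.
      by rewrite wE ucE; move: rho0 tD t5 t5D h3 (h5); clear; lra.
    have := metric_triangle x (c t) w; rewrite (metric_sym (c t) w).
    by move: xt h3 rho0; clear; lra.
  have : mdist (c t) w = h - 5 * rho.
    by rewrite wE ucE; move: rho0 t0 t5 t5D h7 (h5); clear; lra.
  have := metric_triangle x (c t) w.
  by move: xt h7 rho0; clear; lra.
exists (t - 5 * rho + h).
  by apply/andP; move: rho0 t5 t5D h3 h7; clear; split; lra.
rewrite -wE.
have fw : `|f w| <= e.
  apply: (@line_middle (f a) (f b) _ (10 * rho)).
  - by rewrite -tmp; exact: fi.
  - by rewrite -hE -aw; exact: fi.
  - by rewrite -hE -wb (metric_sym w); exact: fi.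
  - by rewrite -hE; move: rho0 h3 fb2 xb eE; clear; lra.
  - by rewrite -hE; move: rho0 h3 eE; clear; lra.
have /fn := xw; rewrite ler_norml => /andP[+ _]; move: fw rho0; rewrite eE; clear; lra.
Qed.

(** Halving can be iterated, since its hypotheses persist for smaller [rho]: the curve comes within
    [rho / 2 ^+ n] of [x] for all [n], which gives the equality up to twice this error. *)
Lemma unit_speed_through X (x : X) (c : R -> X) (D r0 t rho : R) :
  (forall r, 0 < r < r0 -> line_like x (1000^-1) r) ->
  unit_speed D c -> 0 <= t <= D -> 0 < rho -> mdist x (c t) <= rho ->
  6 * rho <= mdist x (c 0) -> 6 * rho <= mdist x (c D) -> 10 * rho < r0 ->
  mdist (c 0) x + mdist x (c D) = mdist (c 0) (c D).
Proof.
move=> line uc tD rho0 xt x0 xD rr.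
have D0 : 0 <= D by move: tD => /andP[]; exact: le_trans.
have H n : exists2 s, 0 <= s <= D & mdist x (c s) <= rho / 2 ^+ n.
  elim: n => [|n [s sD xs]]; first by exists t => //; rewrite expr0 divr1.
  have p1 : 1 <= 2 ^+ n :> R by apply: exprn_ege1; lra.
  have p0 : 0 < rho / 2 ^+ n by rewrite divr_gt0//; lra.
  have p2 : rho / 2 ^+ n <= rho by rewrite ler_pdivrMr ?ler_pMr//; lra.
  have [|||s' s'D xs'] := unit_speed_halving line uc sD p0 xs; try lra.
  by exists s' => //; rewrite exprSr invfM mulrA.
apply/eqP; rewrite eq_le metric_triangle andbT; apply/ler_addgt0Pr => e e0.
have [n ne] : exists n, rho / 2 ^+ n < e / 2.
  have e2 : 0 < e / 2 / rho by rewrite !divr_gt0.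
  have [n ne] := exists_invS_lt e2.
  exists n; rewrite mulrC -ltr_pdivlMr//; apply: le_lt_trans ne.
  rewrite lef_pV2 ?posrE ?exprn_gt0//.
  by rewrite -natrX ler_nat ltn_expl.
have [s /andP[s0 sD] xs] := H n.
have us : mdist (c 0) (c s) = s by rewrite uc ?lexx ?s0 ?D0// sub0r normrN ger0_norm.
have uD : mdist (c s) (c D) = D - s by rewrite uc ?lexx ?s0 ?D0// distrC ger0_norm// subr_ge0.
have -> : mdist (c 0) (c D) = D by rewrite uc ?lexx ?D0// sub0r normrN ger0_norm.
have := metric_triangle (c 0) (c s) x; have := metric_triangle x (c s) (c D).
rewrite (metric_sym (c s) x); lra.
Qed.

(** The neck is [x] itself, with [a0] and [p0] at coordinates about [- r / 4] and [r / 4]: a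
    geodesic between points near them passes close to [x], hence through it by
    [unit_speed_through]. *)
Lemma line_like_funnel X (x : X) (r0 : R) : 0 < r0 ->
  (forall r, 0 < r < r0 -> line_like x (1000^-1) r) ->
  (forall a p (e : R), 0 < e ->
    exists2 q, mdist a q < e & exists g : geo X, g 0%:i01 = q /\ g 1%:i01 = p) ->
  exists z : X, funnel z.
Proof.
move=> r00 line dg; have [r rE] : exists r, r = r0 / 2 by exists (r0 / 2).
have rr0 : 0 < r < r0 by apply/andP; rewrite rE; split; lra.
have [f [fx fi fs]] := line _ rr0.
have [r_gt0 _] := andP rr0.
move: {-2}(1000^-1 * r) (erefl (1000^-1 * r)) fi fs => e eE0 fi fs.
have {eE0}eE : e = r / 1000 by lra.
have fn := line_like_norm fx (ltW r_gt0) fi.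
have [|a0 xa0 fa0] := fs (- (r / 4)); first by rewrite normrN gtr0_norm; lra.
have [|p0 xp0 fp0] := fs (r / 4); first by rewrite gtr0_norm; lra.
have := fn _ xa0; have := fn _ xp0.
move: fa0 fp0; rewrite !(ler_norml _ e).
move=> /andP[fa1 fa2] /andP[fp1 fp2].
have fa0n : f a0 < 0 by move: fa2 eE r_gt0; clear; lra.
have fp0p : 0 < f p0 by move: fp1 eE r_gt0; clear; lra.
rewrite (ltr0_norm fa0n) (gtr0_norm fp0p).
move=> /andP[xp1 xp2] /andP[xa1 xa2].
exists p0, x, [set a | mdist a0 a < r / 100], [set p | mdist p0 p < r / 100]; split.
- by apply/eqP => p0x; move: fp0p; rewrite p0x fx ltxx.
- exact: open_mdist_ball.
- by exists a0; rewrite /= mdistxx divr_gt0.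
- by apply/nbhs_mdist_exP; exists (r / 100) => //; exact: divr_gt0.
have main q p (g : geo X) : g 0%:i01 = q -> g 1%:i01 = p ->
    mdist a0 q < r / 100 -> mdist p0 p < r / 100 ->
    mdist q x + mdist x p = mdist q p.
  move=> <- <-; have [D [c [D0 uc <- <-]]] := geo_unit_speed g => aa pp.
  have xc0 : mdist x (c 0) <= 4 * (r / 10).
    by have := metric_triangle x a0 (c 0); move: aa xa1 fa1 eE r_gt0; clear; lra.
  have xcD : mdist x (c D) <= 4 * (r / 10).
    by have := metric_triangle x p0 (c D); move: pp xp1 fp2 eE r_gt0; clear; lra.
  have xc0r : mdist x (c 0) <= r by move: xc0 r_gt0; clear; lra.
  have xcDr : mdist x (c D) <= r by move: xcD r_gt0; clear; lra.
  have ucE s s' : 0 <= s -> s <= s' -> s' <= D -> mdist (c s) (c s') = s' - s.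
    move=> s0 ss sD; rewrite uc; last by rewrite sD (le_trans s0).
      by rewrite distrC ger0_norm// subr_ge0.
    by rewrite s0 (le_trans ss).
  have DE : mdist (c 0) (c D) = D by rewrite ucE// subr0.
  have /andP[fc1 fc2] : - (12 * (r / 1000)) <= f a0 - f (c 0) <= 12 * (r / 1000).
    have := fi _ _ xa0 xc0r; rewrite (ler_norml _ e) => /andP[_]; rewrite -ler_norml.
    by move: aa eE r_gt0; clear; lra.
  have /andP[fd1 fd2] : - (12 * (r / 1000)) <= f p0 - f (c D) <= 12 * (r / 1000).
    have := fi _ _ xp0 xcDr; rewrite (ler_norml _ e) => /andP[_]; rewrite -ler_norml.
    by move: pp eE r_gt0; clear; lra.
  have fD := fi _ _ xc0r xcDr; rewrite DE in fD.
  have fc0m : f (c 0) <= - (23 * (r / 100)) by move: fc1 fa2 eE r_gt0; clear; lra.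
  have fc0M : - (27 * (r / 100)) <= f (c 0) by move: fc2 fa1 eE r_gt0; clear; lra.
  have fcDm : 23 * (r / 100) <= f (c D) by move: fd2 fp1 eE r_gt0; clear; lra.
  have fcDM : f (c D) <= 27 * (r / 100) by move: fd1 fp2 eE r_gt0; clear; lra.
  have fc0 : `|f (c 0)| = - f (c 0) by rewrite ler0_norm//; move: fc0m r_gt0; clear; lra.
  have fcD : `|f (c D)| = f (c D) by rewrite ger0_norm//; move: fcDm r_gt0; clear; lra.
  have DD : f (c D) - f (c 0) - e <= D.
    have f0D : f (c 0) - f (c D) < 0 by move: fc0m fcDm r_gt0; clear; lra.
    by move: fD; rewrite (ltr0_norm f0D) ler_norml => /andP[_]; clear; lra.
  (* The point of the geodesic as far from its start as 0 is from [f (c 0)]; [line_middle] applies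
     to it. *)
  have [h hE] : exists h, h = - f (c 0) by eexists.
  have h0 : 0 <= h by rewrite hE; move: fc0m r_gt0; clear; lra.
  have hD : h <= D by rewrite hE; move: DD fcDm eE r_gt0; clear; lra.
  have c0w : mdist (c 0) (c h) = h by rewrite ucE// subr0.
  have wcD : mdist (c h) (c D) = D - h by rewrite ucE.
  have hr : h <= 3 * (r / 10) by rewrite hE; move: fc0M r_gt0; clear; lra.
  have xw : mdist x (c h) <= r by have := metric_triangle x (c 0) (c h); move: xc0 hr c0w r_gt0; clear; lra.
  have fw : `|f (c h)| <= e.
    apply: (@line_middle (f (c 0)) (f (c D)) _ D) => //.
    - by rewrite fc0 -hE -[X in _ - X]c0w; apply: fi.
    - by rewrite fc0 -hE -wcD (metric_sym (c h)); apply: fi.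
    - by rewrite fc0 fcD; move: DD fc0m fcDM eE r_gt0; clear; lra.
    - by rewrite fc0; move: fc0m eE r_gt0; clear; lra.
  (* [r / 500] is [2 * e]: one error bounds [f (c h)], the other compares [f] with the distance to
     [x]. *)
  have [rho rhoE] : exists rho, rho = r / 500 by eexists.
  have xw2 : mdist x (c h) <= rho.
    by have := fn _ xw; rewrite ler_norml => /andP[+ _]; move: fw eE; rewrite rhoE; clear; lra.
  have xc0' : 6 * rho <= mdist x (c 0).
    have := fn _ xc0r; rewrite fc0 ler_norml => /andP[_].
    by move: fc0m eE r_gt0; rewrite rhoE; clear; lra.
  have xcD' : 6 * rho <= mdist x (c D).
    have := fn _ xcDr; rewrite fcD ler_norml => /andP[_].
    by move: fcDm eE r_gt0; rewrite rhoE; clear; lra.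
  apply: (@unit_speed_through X x c D r0 h rho) => //.
  - by rewrite h0.
  - by move: r_gt0; rewrite rhoE; clear; lra.
  - by move: rE r00; rewrite rhoE; clear; lra.
move=> a p aa pp; apply/eqP; rewrite eq_le metric_triangle andTb.
(* Geodesics to [p] are available only from points [q] arbitrarily near [a]; the equality passes to
   [a] by approximation. *)
apply/ler_addgt0Pr => eta eta0.
have : 0 < Num.min (eta / 2) (r / 100 - mdist a0 a) by rewrite lt_min subr_gt0; apply/andP; split; [lra|].
move=> /(dg a p)[q]; rewrite lt_min => /andP[aq1 aq2] [g [g0 g1]].
have /(main _ _ _ g0 g1)/(_ pp) qE : mdist a0 q < r / 100.
  by have := metric_triangle a0 a q; move: aq2; clear; lra.
have := metric_triangle a q x; have := metric_triangle q a p.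
rewrite (metric_sym q a); move: qE aq1; clear; lra.
Qed.

End one_dimensional_geometry.

(** * Optimal transport *)

Section borel_sets.
Context {R : realType}.

Lemma borel_open (T : ptopologicalType) (A : set T) :
  open A -> measurable (A : set (borel T)).
Proof. by move=> oA; exact: sub_sigma_algebra. Qed.

Lemma borel_closed (T : ptopologicalType) (A : set T) :
  closed A -> measurable (A : set (borel T)).
Proof.
move=> cA; rewrite -(setCK A); apply: measurableC; apply: borel_open.
exact: closed_openC.
Qed.

Lemma borel_continuous_real (S : ptopologicalType) (f : S -> R) :
  continuous f -> measurable_fun setT (f : borel S -> R).
Proof.
move=> cf; apply: (measurability _ (RGenOpens.measurableE R)).
move=> _ [_ [a [b ->] <-]]; rewrite setTI; apply: borel_open.
by apply: open_comp => [x _|]; [exact: cf|exact: interval_open].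
Qed.

End borel_sets.

Section mixture.
Context d (T : measurableType d) (R : realType) (P Q : probability T R).

Definition mixture : set T -> \bar R :=
  measure_add (mscale (2^-1)%:nng P) (mscale (2^-1)%:nng Q).

HB.instance Definition _ := Measure.on mixture.

Lemma mixtureE A : mixture A = (2^-1%:E * P A + 2^-1%:E * Q A)%E.
Proof. by rewrite /mixture measure_addE. Qed.

Lemma mixture_setT : mixture setT = 1%E.
Proof. by rewrite mixtureE !probability_setT !mule1 -EFinD; congr EFin; lra. Qed.

HB.instance Definition _ := Measure_isProbability.Build _ _ _ mixture mixture_setT.

End mixture.

Section transport.
Context {R : realType} {X : completeMetricType R}.
Implicit Types (m : {measure set (borel X) -> \bar R}).

Lemma borel_mdist_sqr (p : X) :
  measurable_fun setT (fun x : borel X => ((mdist (x : X) p) ^+ 2)%:E).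
Proof.
apply/measurable_EFinP; apply: measurable_funX; apply: borel_continuous_real.
rewrite (_ : (fun x : X => _) = mdist p); first exact: mdist_continuous.
by apply/funext => y; exact: metric_sym.
Qed.

(** Normalise the restriction of [m] to a small open part [B] of [A]: its mass is positive by full
    support and finite by local finiteness, and [B] is bounded, so the second moment is finite. *)
Lemma exists_P2ac m (A : set X) : locally_finite_measure m ->
  measure_support m = [set: X] -> open A -> A !=set0 ->
  exists2 mu0 : probability (borel X) R, P2ac m mu0 & mu0 (~` A) = 0%E.
Proof.
move=> fm sm oA [a Aa]; have [U [oU Ua] mU] := fm a.
pose B := A `&` (U `&` [set x | mdist a x < 1]).
have oB : open B.
  by apply: openI => //; apply: openI => //; exact: open_mdist_ball.
have Ba : B a by split=> //; split=> //=; rewrite mdistxx.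
have mB : measurable (B : set (borel X)) := borel_open oB.
have mB0 : (0 < m B)%E.
  have : measure_support m a by rewrite sm.
  exact.
have mBoo : (m B < +oo)%E.
  apply: le_lt_trans mU; apply: le_measure; rewrite ?inE//.
    exact: borel_open.
  by move=> x [_ []].
(* The Dirac mass is the fallback of [mnormalize] for mass zero or infinity, excluded here. *)
pose mu0 : probability (borel X) R := mnormalize (mrestr m mB) (\d_ (a : borel X)).
have mu0E S : mu0 S = (m (S `&` B) * (fine (m B))^-1%:E)%E.
  have mT : mrestr m mB setT = m B by rewrite /mrestr setTI.
  by rewrite /mu0/= /mnormalize/= mT gt_eqF//= lt_eqF.
have mu0B S : S `&` B = set0 -> mu0 S = 0%E.
  by move=> SB; rewrite mu0E SB measure0 mul0e.
exists mu0; last by apply: mu0B; rewrite -subset0 => x [nA [Ax]].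
split; last first.
  move=> N mN S mS SN; rewrite mu0E (mN (S `&` B)) ?mul0e//.
    exact: measurableI.
  by move=> x [/SN].
exists a; apply: (@le_lt_trans _ _ (\int[mu0]_x (cst 1%E x)))%E; last first.
  by rewrite integral_cst// mul1e; apply: (@le_lt_trans _ _ 1%E); [exact: probability_le1|exact: ltry].
apply: ae_ge0_le_integral => //.
- by move=> x _; rewrite lee_fin sqr_ge0.
- exact: borel_mdist_sqr.
- exists (~` B); split.
  + exact: measurableC.
  + by apply: mu0B; rewrite setICl.
  + move=> x /= H Bx; apply: H => _; rewrite lee_fin metric_sym.
    case: Bx => _ [_ /= ax]; rewrite expr_le1//; [exact: ltW|exact: mdist_ge0].
Qed.

Lemma P2_dirac (p : X) : P2 (\d_ (p : borel X) : probability (borel X) R).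
Proof.
exists p; rewrite integral_dirac//; last exact: borel_mdist_sqr.
by rewrite mdistxx expr0n mule0 ltry.
Qed.

Lemma continuous_mdist2 : continuous (fun z : X * X => mdist z.1 z.2).
Proof.
move=> z; apply/cvgrPdist_le => e e0.
exists ([set x | mdist z.1 x < e / 2], [set x | mdist z.2 x < e / 2]).
  split; apply/nbhs_mdist_exP; exists (e / 2) => //=; exact: divr_gt0.
move=> [w1 w2] /= [zw1 zw2].
have := metric_triangle z.1 w1 z.2; have := metric_triangle w1 z.1 w2.
have := metric_triangle z.1 z.2 w2; have := metric_triangle w1 w2 z.2.
rewrite (metric_sym w1 z.1) (metric_sym w2 z.2) ler_norml.
by move: zw1 zw2; clear; move=> *; apply/andP; split; lra.
Qed.

Lemma borel_fst : measurable_fun setT (fst : borel (X * X)%type -> borel X).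
Proof.
apply: (@measurability _ _ _ (borel X) _ _ open) => //.
move=> _ [U oU <-]; rewrite setTI; apply: sub_sigma_algebra.
by apply: open_comp => // z _; exact: cvg_fst.
Qed.

Lemma borel_snd : measurable_fun setT (snd : borel (X * X)%type -> borel X).
Proof.
apply: (@measurability _ _ _ (borel X) _ _ open) => //.
move=> _ [U oU <-]; rewrite setTI; apply: sub_sigma_algebra.
by apply: open_comp => // z _; exact: cvg_snd.
Qed.

Lemma borel_mdist2 :
  measurable_fun setT (fun z : borel (X * X)%type => mdist z.1 z.2).
Proof.
apply: (measurability _ (RGenOpens.measurableE R)).
move=> _ [_ [a [b ->] <-]]; rewrite setTI; apply: sub_sigma_algebra.
apply: open_comp => [z _|]; [exact: continuous_mdist2|exact: interval_open].
Qed.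

Lemma marginal1 (mu0 mu1 : probability (borel X) R) sigma (S : set (borel X)) :
  couplings mu0 mu1 sigma -> measurable S -> sigma (fst @^-1` S) = mu0 S.
Proof. by move=> [+ _] mS => /(_ _ mS). Qed.

Lemma marginal2 (mu0 mu1 : probability (borel X) R) sigma (S : set (borel X)) :
  couplings mu0 mu1 sigma -> measurable S -> sigma (snd @^-1` S) = mu1 S.
Proof. by move=> [_ +] mS => /(_ _ mS). Qed.

(* When [p] and [q] are equidistant from every point charged by [mu0], all
   couplings of [mu0] with a measure on [{p, q}] cost the same. *)
Lemma coupling_cost (mu0 mu1 : probability (borel X) R) (A : set X) p q sigma :
  open A -> (forall a, A a -> mdist a p = mdist a q) -> mu0 (~` A) = 0%E ->
  mu1 (~` [set p; q]) = 0%E -> couplings mu0 mu1 sigma ->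
  quadratic_cost sigma = (\int[mu0]_x ((mdist (x : X) p) ^+ 2)%:E)%E.
Proof.
move=> oA Apq A0 pq0 cs; rewrite /quadratic_cost.
have mA : measurable (~` A : set (borel X)).
  by apply: measurableC; exact: borel_open.
have mpq : measurable (~` [set p; q] : set (borel X)).
  apply: measurableC; apply: borel_closed.
  have /hausdorff_accessible aX := @metric_hausdorff R X.
  by apply: closedU; exact: accessible_closed_set1.
transitivity (\int[sigma]_z ((mdist (z.1 : X) p) ^+ 2)%:E)%E; last first.
  have -> : (\int[mu0]_x ((mdist (x : X) p) ^+ 2)%:E =
      \int[pushforward sigma (fst : borel (X * X)%type -> borel X)]_x
        ((mdist (x : X) p) ^+ 2)%:E)%E.
    apply: eq_measure_integral => [|mf S mS _]; first exact: borel_fst.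
    exact/esym/(cs.1 S mS).
  rewrite ge0_integral_pushforward//.
  - exact: borel_fst.
  - exact: borel_mdist_sqr.
  - by move=> x _; rewrite lee_fin sqr_ge0.
apply: ge0_ae_eq_integral => //.
- by apply/measurable_EFinP; apply: measurable_funX; exact: borel_mdist2.
- exact: (measurableT_comp (borel_mdist_sqr p) borel_fst).
- by move=> x _; rewrite lee_fin sqr_ge0.
- by move=> x _; rewrite lee_fin sqr_ge0.
have m1 : measurable ((fst : borel (X * X)%type -> borel X) @^-1` (~` A)).
  by rewrite -[X in measurable X]setTI; exact: borel_fst.
have m2 : measurable ((snd : borel (X * X)%type -> borel X) @^-1` (~` [set p; q])).
  by rewrite -[X in measurable X]setTI; exact: borel_snd.
exists (fst @^-1` (~` A) `|` snd @^-1` (~` [set p; q])); split.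
- exact: measurableU.
- apply/eqP; rewrite -measure_le0; apply: (le_trans (measureU2 _ m1 m2)).
  have s1 := etrans (marginal1 cs mA) A0; have s2 := etrans (marginal2 cs mpq) pq0.
  by rewrite [X in (X + _)%E]s1 [X in (_ + X)%E]s2 adde0.
- move=> [a b] /= ne; apply: contrapT => /not_orP[/= /contrapT Aa /contrapT bpq].
  apply: ne => _; congr ((_ ^+ 2)%:E).
  by case: bpq => -> //; rewrite Apq.
Qed.

Lemma borel_endpoints_preimage (S : set (borel (X * X)%type)) :
  measurable S -> measurable (endpoints @^-1` S : set (borel (geo X))).
Proof.
by move=> mS; rewrite -[X in measurable X]setTI; exact: measurable_endpoints.
Qed.

Lemma borel_fst_preimage (S : set (borel X)) :
  measurable S -> measurable (fst @^-1` S : set (borel (X * X)%type)).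
Proof. by move=> mS; rewrite -[X in measurable X]setTI; exact: borel_fst. Qed.

Lemma borel_snd_preimage (S : set (borel X)) :
  measurable S -> measurable (snd @^-1` S : set (borel (X * X)%type)).
Proof. by move=> mS; rewrite -[X in measurable X]setTI; exact: borel_snd. Qed.

Lemma borel_set1 (p : X) : measurable ([set p] : set (borel X)).
Proof.
apply: borel_closed; apply: accessible_closed_set1.
exact/hausdorff_accessible/metric_hausdorff.
Qed.

Definition unique_transport_maps m := forall mu0 mu1 : probability (borel X) R,
       P2ac m mu0 -> P2 mu1 ->
       exists p : probability (borel (geo X)) R,
         [/\ OptGeo mu0 mu1 p,
             forall p' : probability (borel (geo X)) R,
               OptGeo mu0 mu1 p' -> measure_eq p' p
           & induced_by_map mu0 p].

Lemma geodesic_of_ac m : locally_finite_measure m ->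
  measure_support m = [set: X] ->
  unique_transport_maps m ->
  forall (a p : X) (e : R), 0 < e ->
    exists2 q, mdist a q < e & exists g : geo X, g 0%:i01 = q /\ g 1%:i01 = p.
Proof.
move=> fm sm tm a p e e0.
have oA : open [set x | mdist a x < e] by exact: open_mdist_ball.
have A0 : [set x | mdist a x < e] !=set0 by exists a; rewrite /= mdistxx.
have [mu0 ac0 mu0A] := exists_P2ac fm sm oA A0.
have [pi [[cs _] _ [T [mT piT T0]]]] := tm _ _ ac0 (P2_dirac p).
apply: contrapT => nex.
have mp : measurable (~` [set p] : set (borel X)).
  by apply: measurableC; exact: borel_set1.
pose G : set (borel (geo X)) := endpoints @^-1` (snd @^-1` (~` [set p])).
have mG : measurable G.
  by apply: borel_endpoints_preimage; exact: borel_snd_preimage.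
have G0 : mu0 (T @^-1` G) = 0%E.
  rewrite -[LHS]/(pushforward mu0 T G) -(piT _ mG).
  have := marginal2 cs mp; rewrite /= diracE memNset//.
  by move=> /(_ erefl).
have mTG : measurable (T @^-1` G) by rewrite -[X in measurable X]setTI; exact: mT.
have mA : measurable (~` [set x | mdist a x < e] : set (borel X)).
  by apply: measurableC; exact: borel_open.
pose B := [set x | mdist a x < e].
have : (mu0 (T @^-1` G `|` ~` B) <= 0)%E.
  apply: (le_trans (measureU2 _ mTG mA)).
  by rewrite [X in (X + _)%E]G0 [X in (_ + X)%E]mu0A adde0.
rewrite (_ : _ `|` _ = setT) ?probability_setT ?lee_fin ?ler10//.
rewrite -subTset => x _; have [ax|nax] := pselect (mdist a x < e); last by right.
left => Txp; apply: nex; exists x => //; exists (T x); split; [exact: T0|exact: Txp].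
Qed.

(** The map [T] inducing the optimal plan sends a set [S] of mass 1/2 to [p], so this plan does not
    charge the geodesics from [S] to [q]. The half-sum of the plans to the two Dirac masses is
    optimal too, but gives them mass at least 1/4. *)
Lemma equidistant_eq m : locally_finite_measure m ->
  measure_support m = [set: X] ->
  unique_transport_maps m ->
  forall (A : set X) p q, open A -> A !=set0 ->
    (forall a, A a -> mdist a p = mdist a q) -> p = q.
Proof.
move=> fm sm tm A p q oA A0 Apq; apply: contrapT => npq.
have [mu0 ac0 mu0A] := exists_P2ac fm sm oA A0.
pose mu1 : probability (borel X) R := mixture (\d_ (p : borel X)) (\d_ (q : borel X)).
have mu1E S : mu1 S = (2^-1%:E * \d_ (p : borel X) S + 2^-1%:E * \d_ (q : borel X) S)%E.
  exact: mixtureE.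
have mpq : measurable (~` [set p; q] : set (borel X)).
  by apply: measurableC; apply: measurableU; exact: borel_set1.
have mu1pq : mu1 (~` [set p; q]) = 0%E.
  rewrite mu1E !diracE !memNset/= ?mule0 ?adde0//; apply; by [left|right].
have P2mu1 : P2 mu1.
  exists p; apply: (@le_lt_trans _ _ (\int[mu1]_x (cst ((mdist q p) ^+ 2)%:E x)))%E.
    apply: ae_ge0_le_integral => //.
    - by move=> x _; rewrite lee_fin sqr_ge0.
    - exact: borel_mdist_sqr.
    - by move=> x _; rewrite lee_fin sqr_ge0.
    exists (~` [set p; q]); split=> // x /= H; apply: contra_not H => -[->|->] _ //.
    by rewrite mdistxx expr0n lee_fin sqr_ge0.
  rewrite integral_cst// [X in (_ * X)%E](_ : _ = 1%E) ?mule1 ?ltry//.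
  exact: probability_setT.
have [pi [og uniq [T [mT piT T0]]]] := tm _ _ ac0 P2mu1.
have [pip [[cp _] _ _]] := tm _ _ ac0 (P2_dirac p).
have [piq [[cq _] _ _]] := tm _ _ ac0 (P2_dirac q).
pose pim : probability (borel (geo X)) R := mixture pip piq.
have pimE S : pim S = (2^-1%:E * pip S + 2^-1%:E * piq S)%E by exact: mixtureE.
have half (x : \bar R) : (0 <= x)%E -> (2^-1%:E * x + 2^-1%:E * x = x)%E.
  move=> x0; rewrite -ge0_muleDl ?lee_fin ?invr_ge0// -EFinD.
  by rewrite (_ : 2^-1 + 2^-1 = 1) ?mul1e//; lra.
have cm : couplings mu0 mu1 (distribution pim endpoints).
  split=> S mS.
    have := marginal1 cp mS; have := marginal1 cq mS => /= eq ep.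
    rewrite -[LHS]/(pim (endpoints @^-1` (fst @^-1` S))) pimE.
    rewrite -[X in (_ * X + _)%E]/(distribution pip endpoints (fst @^-1` S)).
    rewrite -[X in (_ + _ * X)%E]/(distribution piq endpoints (fst @^-1` S)).
    by rewrite ep eq half.
  have := marginal2 cp mS; have := marginal2 cq mS => /= eq ep.
  rewrite -[LHS]/(pim (endpoints @^-1` (snd @^-1` S))) pimE mu1E.
  rewrite -[X in (_ * X + _)%E]/(distribution pip endpoints (snd @^-1` S)).
  rewrite -[X in (_ + _ * X)%E]/(distribution piq endpoints (snd @^-1` S)).
  by rewrite ep eq.
(* By [coupling_cost] all couplings of [mu0] and [mu1] have the same cost. *)
have om : OptGeo mu0 mu1 pim.
  split=> // sigma cs.
  by rewrite (coupling_cost oA Apq mu0A mu1pq cm) (coupling_cost oA Apq mu0A mu1pq cs).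
have pimpi := uniq _ om.
pose Gp : set (borel (geo X)) := endpoints @^-1` (snd @^-1` [set p]).
have mGp : measurable Gp.
  by apply: borel_endpoints_preimage; apply: borel_snd_preimage; exact: borel_set1.
pose S : set (borel X) := T @^-1` Gp.
have mS : measurable S by rewrite -[X in measurable X]setTI; exact: mT.
have S12 : mu0 S = 2^-1%:E.
  rewrite -[LHS]/(pushforward mu0 T Gp) -(piT _ mGp).
  rewrite -[LHS]/(distribution pi endpoints (snd @^-1` [set p])).
  have [co _] := og; rewrite (marginal2 co (borel_set1 p)) mu1E !diracE.
  rewrite mem_set// memNset/= ?mule1 ?mule0 ?adde0// => /esym; exact: npq.
pose E : set (borel (geo X)) := endpoints @^-1` (fst @^-1` S `&` snd @^-1` [set q]).
have mE : measurable E.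
  apply: borel_endpoints_preimage; apply: measurableI; first exact: borel_fst_preimage.
  by apply: borel_snd_preimage; exact: borel_set1.
have E0 : pim E = 0%E.
  rewrite (pimpi _ mE) (piT _ mE) /pushforward (_ : T @^-1` E = set0) ?measure0//.
  rewrite -subset0 => x [/=]; rewrite /S/= /Gp/= /endpoints/geo_ends/= T0 => -> pq.
  exact: npq.
(* Almost all geodesics of [piq] end at [q], so [E] has the mass of those that start in [S]. *)
have qE : (2^-1%:E <= piq E)%E.
  pose F : set (borel (geo X)) := endpoints @^-1` (snd @^-1` (~` [set q])).
  have mq : measurable (~` [set q] : set (borel X)).
    by apply: measurableC; exact: borel_set1.
  have mF : measurable F.
    by apply: borel_endpoints_preimage; exact: borel_snd_preimage.
  have F0 : piq F = 0%E.
    have := marginal2 cq mq; rewrite /= diracE memNset//.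
    by move=> /(_ erefl).
  pose H : set (borel (geo X)) := endpoints @^-1` (fst @^-1` S).
  have mH : measurable H.
    by apply: borel_endpoints_preimage; exact: borel_fst_preimage.
  have HE : piq H = 2^-1%:E by have := marginal1 cq mS; rewrite S12.
  rewrite -HE; apply: (@le_trans _ _ (piq (E `|` F))).
    apply: le_measure; rewrite ?inE//; first exact: measurableU.
    move=> g Hg; have [gq|gq] := pselect (g 1%:i01 = q); [left|right].
      by split; [exact: Hg|exact: gq].
    exact: gq.
  by apply: (le_trans (measureU2 _ mE mF)); rewrite [X in (_ + X)%E]F0 adde0.
have : (0 < pim E)%E.
  rewrite pimE; apply: (@lt_le_trans _ _ (2^-1%:E * 2^-1%:E)%E).
    by rewrite -EFinM lte_fin mulr_gt0.
  apply: (@le_trans _ _ (2^-1%:E * piq E)%E); first by rewrite lee_pmul2l.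
  by rewrite leeDr// mule_ge0// lee_fin.
by rewrite E0 ltxx.
Qed.

End transport.

(** * Ultralimits of rescaled spaces *)

Lemma filter_bounded_forall (T : Type) (F : set_system T) {FF : Filter F}
    (P : nat -> set T) n : (forall m, (m <= n)%N -> F (P m)) ->
  F [set i | forall m, (m <= n)%N -> P m i].
Proof.
elim: n => [|n IH] H.
  by apply: filterS (H 0%N (leqnn _)) => i P0 m; rewrite leqn0 => /eqP ->.
have Pn := IH (fun m mn => H m (leqW mn)).
apply: filterS (filterI Pn (H n.+1 (leqnn _))) => i [/= H1 H2] m.
by rewrite leq_eqVlt => /predU1P[->//|]; rewrite ltnS; exact: H1.
Qed.

(** [scale_cofinite] makes the ultrafilter non-principal. *)
Record scaling (R : realType) := Scaling {
  scale :> nat -> R ;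
  scale_gt0 : forall i, 0 < scale i ;
  scale_filter : set_system nat ;
  scale_ultra : UltraFilter scale_filter ;
  scale_cofinite : forall n, scale_filter [set i | (n <= i)%N] }.

Section ultralimit.
Context {R : realType} {X : completeMetricType R} (x : X) (l : scaling R).

Local Notation w := (scale_filter l).

Local Instance w_ultra : UltraFilter w := scale_ultra l.

(** Compactness of the segment gives a cluster point, which is a limit because an ultrafilter
    contains every set or its complement. *)
Lemma ultra_cvg (u : nat -> R) (M : R) : (forall i, `|u i| <= M) -> cvg (u @ w).
Proof.
move=> uM; have := @segment_compact R (- M) M => /(_ (u @ w) _)[].
  apply: (@filterS _ w _ setT) => [i _|]; last exact: filterT.
  by have := uM i; rewrite /= in_itv/= ler_norml.
move=> L [_ cL]; apply/cvg_ex; exists L; apply/cvgrPdist_lt => e e0.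
have [//|nH] := @in_ultra_setVsetC _ w [set i | `|L - u i| < e] _.
have [||y [/= y1 y2]] := cL [set y | ~ `|L - y| < e] (ball L e).
- exact: nH.
- exact: nbhsx_ballx.
- by [].
Qed.

Definition sbounded (s : nat -> X) := exists M, forall i, l i * mdist x (s i) <= M.

Definition slim (s t : nat -> X) : R := lim ((fun i => l i * mdist (s i) (t i)) @ w).

Lemma sdist_ge0 (s t : nat -> X) i : 0 <= l i * mdist (s i) (t i).
Proof. by rewrite mulr_ge0 ?mdist_ge0// ltW// scale_gt0. Qed.

Lemma sdist_triangle (i : nat) (a b c : X) :
  l i * mdist a c <= l i * mdist a b + l i * mdist b c.
Proof. by rewrite -mulrDr ler_pM2l ?scale_gt0// metric_triangle. Qed.

Lemma slim_cvg s t : sbounded s -> sbounded t ->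
  (fun i => l i * mdist (s i) (t i)) @ w --> slim s t.
Proof.
move=> [M sM] [N tN]; apply: (@ultra_cvg _ (M + N)) => i.
rewrite ger0_norm ?sdist_ge0//; apply: le_trans (sdist_triangle i _ x _) _.
by rewrite lerD// metric_sym.
Qed.

Lemma slim_near s t e : sbounded s -> sbounded t -> 0 < e ->
  w [set i | `|slim s t - l i * mdist (s i) (t i)| < e].
Proof. by move=> bs bt e0; move: e e0; exact/cvgrPdist_lt/slim_cvg. Qed.

Lemma slim_le s t c : sbounded s -> sbounded t ->
  w [set i | l i * mdist (s i) (t i) <= c] -> slim s t <= c.
Proof.
move=> bs bt wc; apply/ler_addgt0Pr => e e0.
have [i [/= H1 H2]] := filter_ex (filterI wc (slim_near bs bt e0)).
by move: H2; rewrite ltr_norml => /andP[_]; move: H1; clear; lra.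
Qed.

Lemma slim_ge s t c : sbounded s -> sbounded t ->
  w [set i | c <= l i * mdist (s i) (t i)] -> c <= slim s t.
Proof.
move=> bs bt wc; apply/ler_addgt0Pr => e e0.
have [i [/= H1 H2]] := filter_ex (filterI wc (slim_near bs bt e0)).
by move: H2; rewrite ltr_norml => /andP[+ _]; move: H1; clear; lra.
Qed.

Lemma slim_ge0 s t : sbounded s -> sbounded t -> 0 <= slim s t.
Proof.
by move=> bs bt; apply: slim_ge => //; apply: filterS filterT => i _; exact: sdist_ge0.
Qed.

Lemma slimxx s : sbounded s -> slim s s = 0.
Proof.
move=> bs; apply/eqP; rewrite eq_le slim_ge0// andbT.
by apply: slim_le => //; apply: filterS filterT => i _ /=; rewrite mdistxx mulr0.
Qed.

Lemma slim_sym s t : slim s t = slim t s.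
Proof. by rewrite /slim; under eq_fun do rewrite metric_sym. Qed.

Lemma slim_triangle s t u : sbounded s -> sbounded t -> sbounded u ->
  slim s u <= slim s t + slim t u.
Proof.
move=> bs bt bu; apply/ler_addgt0Pr => e e0; have e2 : 0 < e / 2 by lra.
apply: slim_le => //.
apply: filterS (filterI (slim_near bs bt e2) (slim_near bt bu e2)) => i /= [].
rewrite !ltr_norml => /andP[+ _] /andP[+ _].
by have := sdist_triangle i (s i) (t i) (u i); clear; lra.
Qed.

(** The quotient of bounded sequences by vanishing [slim], encoded by equivalence classes so that
    points at distance 0 are equal, as a metric requires. *)
Record ulim := Ulim {
  ulim_class : set (nat -> X) ;
  ulimP : exists2 s, sbounded s &
    ulim_class = [set t | sbounded t /\ slim s t = 0] }.

Lemma ulim_eqP u v : ulim_class u = ulim_class v -> u = v.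
Proof.
case: u v => [u uP] [v vP] /= uv; subst v.
by congr Ulim; exact: Prop_irrelevance.
Qed.

Definition urep (u : ulim) : nat -> X := s2val (cid2 (ulimP u)).

Lemma urep_bounded u : sbounded (urep u).
Proof. exact: s2valP (cid2 (ulimP u)). Qed.

Lemma urepE u : ulim_class u = [set t | sbounded t /\ slim (urep u) t = 0].
Proof. exact: s2valP' (cid2 (ulimP u)). Qed.

Definition umk s (bs : sbounded s) : ulim :=
  Ulim (ex_intro2 _ _ s bs (erefl [set t | sbounded t /\ slim s t = 0])).

Lemma slim_umk s (bs : sbounded s) : slim s (urep (umk bs)) = 0.
Proof.
have : ulim_class (umk bs) (urep (umk bs)).
  by rewrite urepE/=; split; [exact: urep_bounded|rewrite slimxx//; exact: urep_bounded].
by case.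
Qed.

Definition udist (u v : ulim) : R := slim (urep u) (urep v).

Lemma udistxx u : udist u u = 0.
Proof. exact/slimxx/urep_bounded. Qed.

Lemma udist_positivity u v : udist u v = 0 -> u = v.
Proof.
move=> uv; apply/ulim_eqP; rewrite !urepE; apply/seteqP.
have bu := urep_bounded u; have bv := urep_bounded v.
split=> t /= [bt t0]; split=> //; apply/eqP; rewrite eq_le slim_ge0// andbT.
  by apply: le_trans (slim_triangle bv bu bt) _; rewrite t0 addr0 slim_sym [leLHS]uv.
by apply: le_trans (slim_triangle bu bv bt) _; rewrite t0 addr0 [leLHS]uv.
Qed.

Lemma udist_sym u v : udist u v = udist v u.
Proof. exact: slim_sym. Qed.

Lemma udist_triangle v u z : udist u z <= udist u v + udist v z.
Proof. by apply: slim_triangle; exact: urep_bounded. Qed.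

HB.instance Definition _ := gen_eqMixin ulim.
HB.instance Definition _ := gen_choiceMixin ulim.
HB.instance Definition _ := @isMetric.Build R ulim udist udistxx
  udist_positivity udist_sym udist_triangle.

Lemma sbounded_cst : sbounded (cst x).
Proof. by exists 0 => i; rewrite mdistxx mulr0. Qed.

Definition ubase : ulim := umk sbounded_cst.

HB.instance Definition _ := isPointed.Build ulim ubase.

Lemma mdist_umk s t (bs : sbounded s) (bt : sbounded t) :
  mdist (umk bs) (umk bt) = slim s t.
Proof.
have rs := urep_bounded (umk bs); have rt := urep_bounded (umk bt).
have s0 := slim_umk bs; have t0 := slim_umk bt.
apply/eqP; rewrite eq_le; apply/andP; split.
  apply: le_trans (slim_triangle rs bs rt) _; rewrite slim_sym s0 add0r.
  by apply: le_trans (slim_triangle bs bt rt) _; rewrite t0 addr0.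
apply: le_trans (slim_triangle bs rs bt) _; rewrite s0 add0r.
by apply: le_trans (slim_triangle rs rt bt) _; rewrite (slim_sym _ t) t0 addr0.
Qed.

Lemma umk_urep u : u = umk (urep_bounded u).
Proof.
apply: mdist_positivity; exact: (slim_umk (urep_bounded u)).
Qed.

Lemma mdist_umk_near s t (bs : sbounded s) (bt : sbounded t) e : 0 < e ->
  w [set i | `|mdist (umk bs) (umk bt) - l i * mdist (s i) (t i)| < e].
Proof. by rewrite mdist_umk; exact: slim_near. Qed.

(* A diagonal sequence: at [i] it follows the [n]-th sequence for the largest
   [n] such that the first [n] sequences are already as close at [i] as in the
   limit. *)
Lemma ulim_complete_seq (u : nat -> ulim) (r : nat -> R) :
  (forall n, 0 < r n) -> {homo r : m n / (m <= n)%N >-> n <= m} ->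
  (forall j k, mdist (u j) (u k) < r j + r k) ->
  exists v : ulim, forall j, mdist (u j) v <= 2 * r j.
Proof.
move=> r0 rd ur; pose s n := urep (u n).
have bs n : sbounded (s n) := urep_bounded (u n).
pose G n := [set i | (n <= i)%N /\ forall j, (j <= n)%N ->
  forall k, (k <= n)%N -> l i * mdist (s j i) (s k i) < r j + r k].
have wG n : w (G n).
  apply: filterI; first exact: scale_cofinite.
  apply: filter_bounded_forall => j _; apply: filter_bounded_forall => k _.
  have e0 : 0 < r j + r k - mdist (u j) (u k) by rewrite subr_gt0.
  apply: filterS (slim_near (bs j) (bs k) e0) => i /=.
  by rewrite ltr_norml -[slim _ _]/(mdist (u j) (u k)) => /andP[+ _]; clear; lra.
have Gd m n i : (m <= n)%N -> G n i -> G m i.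
  move=> mn [ni H]; split; first exact: leq_trans ni.
  by move=> j jm k km; apply: H; [exact: leq_trans mn|exact: leq_trans mn].
have [M sM] := bs 0%N.
have /choice[t tP] : forall i, exists p : X, l i * mdist x p <= `|M| + 2 * r 0%N /\
    forall m, G m i -> l i * mdist (s m i) p <= 2 * r m.
  move=> i; have [G0|nG0] := pselect (G 0%N i); last first.
    exists x; split; first by rewrite mdistxx mulr0 addr_ge0// mulr_ge0// ltW.
    by move=> m /(Gd 0%N _ _ (leq0n _)).
  have exG : exists n, `[< G n i >] by exists 0%N; apply/asboolP.
  (* The clause [n <= i] in [G] bounds the candidates, so a largest one exists. *)
  have [|n /asboolP Gn nmax] := @ex_maxnP (fun n => `[< G n i >]) i exG.
    by move=> n /asboolP[].
  have H m : G m i -> l i * mdist (s m i) (s n i) <= 2 * r m.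
    move=> Gm; have mn : (m <= n)%N by apply: nmax; apply/asboolP.
    have := Gn.2 _ mn _ (leqnn n); have := rd _ _ mn; clear; lra.
  exists (s n i); split=> //.
  have := sdist_triangle i x (s 0%N i) (s n i); have := H _ G0; have := sM i.
  by have := ler_norm M; clear; lra.
have bt : sbounded t by exists (`|M| + 2 * r 0%N) => i; exact: (tP i).1.
exists (umk bt) => j; rewrite [u j]umk_urep mdist_umk; apply: slim_le => //; first exact: urep_bounded.
by apply: filterS (wG j) => i; exact: (tP i).2.
Qed.

Lemma ulim_cauchy_cvg (F : set_system ulim) : ProperFilter F -> cauchy F -> cvg F.
Proof.
move=> FF /cauchyP Fc; pose r n : R := n.+1%:R^-1.
have r0 n : 0 < r n by rewrite invr_gt0.
have /choice[u uP] : forall n, exists u, F (ball u (r n)) by move=> n; exact: Fc.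
have [||v vP] := @ulim_complete_seq u r r0.
- by move=> m n mn; rewrite lef_pV2 ?posrE// ler_nat.
- move=> j k; have [v [/=]] := filter_ex (filterI (uP j) (uP k)).
  rewrite !ballEmdist/= => jv kv.
  by have := metric_triangle (u j) v (u k); rewrite (metric_sym v); move: jv kv; clear; lra.
apply/cvg_ex; exists v; apply/metricType_numDomainType.fcvgrPdist_lt => e e0.
have [n ne] := exists_invS_lt (ltac:(lra) : 0 < e / 3).
apply: filterS (uP n); rewrite ballEmdist => z /= uz.
have := metric_triangle v (u n) z; rewrite (metric_sym v (u n)).
by have := vP n; move: uz ne; rewrite -[_^-1]/(r n); clear; lra.
Qed.

HB.instance Definition _ := Uniform_isComplete.Build ulim ulim_cauchy_cvg.

End ultralimit.

(** * Compactness and convergence of ultralimits *)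

Section ultralimit_compactness.
Context {R : realType} {X : completeMetricType R} (x : X) (l : scaling R).

Local Notation w := (scale_filter l).
Local Notation Y := (ulim x l).

Local Instance w_ultra_filter : UltraFilter w := scale_ultra l.

(** Gromov's precompactness condition along the ultrafilter: [N] does not depend on [i]. The net
    points form sequences [c j], so that each defines a point of the ultralimit, the first one being
    the base point. *)
Definition uniform_nets := forall r e : R, 0 < r -> 0 < e ->
  exists (N : nat) (c : nat -> nat -> X), [/\ (0 < N)%N, c 0%N = cst x,
    forall j, sbounded x l (c j) &
    w [set i | forall y, l i * mdist x y <= r ->
      exists2 j, (j < N)%N & l i * mdist (c j i) y <= e]].

(** A point far from the finitely many limit net points would, at some single index [i], be far from
    all net points at once, against the covering there. *)
Lemma ulim_net_cover (r e : R) N (c : nat -> nat -> X)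
    (bc : forall j, sbounded x l (c j)) (v : Y) :
  w [set i | forall y, l i * mdist x y <= r ->
      exists2 j, (j < N)%N & l i * mdist (c j i) y <= e] ->
  mdist (ubase x l) v < r -> exists2 j, (j < N)%N & mdist (umk (bc j)) v <= e.
Proof.
move=> wc; rewrite [v]umk_urep => vr; apply: contrapT => nex.
have far j : (j <= N)%N ->
    w [set i | (j < N)%N -> e < l i * mdist (c j i) (urep v i)].
  move=> _; have [jN|jN] := ltnP j N; last by apply: filterS filterT => i _.
  have ej : e < mdist (umk (bc j)) (umk (urep_bounded v)).
    by rewrite ltNge; apply/negP => ?; apply: nex; exists j.
  have e0 : 0 < mdist (umk (bc j)) (umk (urep_bounded v)) - e by rewrite subr_gt0.
  apply: filterS (mdist_umk_near (bc j) (urep_bounded v) e0) => i /=.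
  by rewrite ltr_norml => /andP[_ + _]; clear; lra.
have r0 : 0 < r - mdist (ubase x l) (umk (urep_bounded v)) by rewrite subr_gt0.
have near_v := mdist_umk_near (sbounded_cst x l) (urep_bounded v) r0.
have [i [/= [H1 H2] H3]] :=
  filter_ex (filterI (filterI wc (filter_bounded_forall far)) near_v).
have /H1[j jN] : l i * mdist x (urep v i) <= r.
  by move: H3; rewrite /= ltr_norml => /andP[+ _]; clear; lra.
by rewrite leNgt => /negP; apply; apply: H2 => //; exact: ltnW.
Qed.

Lemma ulim_separable : uniform_nets -> separable Y.
Proof.
move=> nets.
have /choice[N /choice[c cP]] : forall n : nat, exists N (c : nat -> nat -> X),
    [/\ (0 < N)%N, c 0%N = cst x,
    forall j, sbounded x l (c j) &
    w [set i | forall y, l i * mdist x y <= n.+1%:R ->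
      exists2 j, (j < N)%N & l i * mdist (c j i) y <= n.+1%:R^-1]].
  by move=> n; apply: nets; rewrite ?invr_gt0.
have bc n j : sbounded x l (c n j) by case: (cP n).
exists [set umk (bc u.1 u.2) | u in [set: nat * nat]].
  by apply: (sub_countable (card_image_le _ _)).
move=> O [v Ov] oO; have /nbhs_mdist_exP[e e0 eO] : nbhs v O by exact: open_nbhs_nbhs.
have [n1 n1e] := exists_invS_lt e0.
pose n := maxn n1 (Num.bound (mdist (ubase x l) v)).
have ne : n.+1%:R^-1 < e.
  apply: le_lt_trans n1e; rewrite lef_pV2 ?posrE// ler_nat ltnS.
  exact: leq_maxl.
have vn : mdist (ubase x l) v < n.+1%:R.
  apply: lt_le_trans (archi_boundP (mdist_ge0 _ _)) _.
  by rewrite ler_nat leqW// leq_maxr.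
have [_ _ _ wc] := cP n.
have [j _ jv] := ulim_net_cover (bc n) wc vn.
exists (umk (bc n j)); split; last by exists (n, j).
by apply: eO; rewrite metric_sym; exact: le_lt_trans jv ne.
Qed.

Lemma closed_mdist_ball (v : Y) (r : R) : closed [set z | mdist v z <= r].
Proof.
rewrite (_ : [set _ | _] = mdist v @^-1` [set t | t <= r])//.
by apply: closed_comp => [z _|]; [exact: mdist_continuous|exact: closed_le].
Qed.

(** Finite nets make every ultrafilter on the ball Cauchy, and the ultralimit is complete. *)
Lemma ulim_ball_compact (r : R) : 0 < r -> uniform_nets ->
  compact [set z : Y | mdist (ubase x l) z <= r].
Proof.
move=> r0 nets; rewrite compact_ultra => F FU FK.
have Fc : cauchy F.
  apply: cauchy_exP => e e0.
  have [||N [c [N0 c0 bc wc]]] := nets (r + 1) (e / 2); try lra.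
  apply: contrapT => nF.
  have H j : (j <= N)%N -> F [set z : Y | ~ mdist (umk (bc j)) z < e].
    move=> _; have [Fb|//] := in_ultra_setVsetC [set z : Y | mdist (umk (bc j)) z < e] FU.
    by exfalso; apply: nF; exists (umk (bc j)); rewrite ballEmdist.
  have HF : F [set z : Y | forall j, (j <= N)%N -> ~ mdist (umk (bc j)) z < e].
    exact: filter_bounded_forall.
  have [z [/= zK Hz]] := filter_ex (filterI FK HF).
  have [|j jN jz] := ulim_net_cover bc wc (v := z).
    by apply: le_lt_trans zK _; rewrite ltrDl.
  by apply: (Hz j (ltnW jN)); move: jz e0; clear; lra.
have Fv : F --> lim F by exact: cauchy_cvg.
exists (lim F); split => //=; rewrite leNgt; apply/negP => rv.
have e0 : 0 < mdist (ubase x l) (lim F) - r by rewrite subr_gt0.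
have FF : Filter F by exact: ultra_proper.
have Fz := (@metricType_numDomainType.fcvgrPdist_lt R Y F FF (lim F)).1 Fv _ e0.
have [z [/= oz zv]] := filter_ex (filterI FK Fz).
have := metric_triangle (ubase x l) z (lim F); rewrite (metric_sym z).
by move: oz zv; clear; lra.
Qed.

Lemma ulim_locally_compact : uniform_nets -> locally_compact [set: Y].
Proof.
move=> nets v _; rewrite withinET.
exists [set z : Y | mdist (ubase x l) z <= mdist (ubase x l) v + 1].
  apply/nbhs_mdist_exP; exists 1 => // z vz /=.
  by have := metric_triangle (ubase x l) v z; move: vz; clear; lra.
split; last exact: closed_mdist_ball.
by apply: ulim_ball_compact => //; rewrite ltr_wpDl ?mdist_ge0.
Qed.

Lemma mdist_umk_scale (s t s' t' : nat -> X) (bs : sbounded x l s)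
    (bt : sbounded x l t) (bs' : sbounded x l s') (bt' : sbounded x l t') (k : R) :
  (forall i, mdist (s i) (t i) = k * mdist (s' i) (t' i)) ->
  mdist (umk bs) (umk bt) = k * mdist (umk bs') (umk bt').
Proof.
move=> H; rewrite !mdist_umk.
apply: (@cvg_unique _ (@Rhausdorff R)) (slim_cvg bs bt) _.
rewrite (_ : (fun i => _) = (fun i => k * (l i * mdist (s' i) (t' i)))).
  by apply: cvgM; [exact: cvg_cst|exact: slim_cvg bs' bt'].
by apply/funext => i; rewrite H mulrCA.
Qed.

Lemma slim_eq0 (s t : nat -> X) (bs : sbounded x l s) (bt : sbounded x l t) :
  (forall e : R, 0 < e -> w [set i | l i * mdist (s i) (t i) <= e]) ->
  slim l s t = 0.
Proof.
move=> H; apply/eqP; rewrite eq_le (slim_ge0 bs bt) andbT.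
by apply/ler_addgt0Pr => e e0; rewrite add0r; apply: (slim_le bs bt); exact: H.
Qed.

(** A limit of geodesics along the ultrafilter is a geodesic. Those of [X] start only near the given
    points, within [(i.+1 * l i)^-1], an error that still tends to 0 after rescaling by [l i]. *)
Lemma ulim_geodesic_space :
  (forall a p (e : R), 0 < e -> exists2 q, mdist a q < e &
     exists g : geo X, g 0%:i01 = q /\ g 1%:i01 = p) ->
  geodesic_space Y.
Proof.
move=> dg u v.
have e0 i : 0 < (i.+1%:R * l i)^-1 by rewrite invr_gt0 mulr_gt0// scale_gt0.
have /choice[g gP] : forall i, exists g : geo X,
    g 1%:i01 = urep v i /\ mdist (urep u i) (g 0%:i01) < (i.+1%:R * l i)^-1.
  move=> i; have [q uq [g [g0 g1]]] := dg (urep u i) (urep v i) _ (e0 i).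
  by exists g; rewrite g0.
have lg0 i : l i * mdist (urep u i) (g i 0%:i01) < i.+1%:R^-1.
  rewrite mulrC -ltr_pdivlMr ?scale_gt0// -invfM; exact: (gP i).2.
have [M uM] := urep_bounded u; have [M' vM] := urep_bounded v.
have bg t : sbounded x l (fun i => g i t).
  exists (M' + (1 + M + M')) => i.
  have [p [E up]] : exists p, l i * mdist (urep v i) (g i t) <= l i * mdist p (urep v i) /\
      l i * mdist (urep u i) p < i.+1%:R^-1.
    exists (g i 0%:i01); split => //; rewrite -(gP i).1.
    rewrite ler_pM2l ?scale_gt0// (geoP (g i)) ler_piMl ?mdist_ge0//=.
    by rewrite ger0_norm ?subr_ge0// lerBlDr lerDl.
  have T1 := sdist_triangle l i x (urep v i) (g i t).
  have T2 := sdist_triangle l i p (urep u i) (urep v i).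
  have T3 := sdist_triangle l i (urep u i) x (urep v i).
  have i1 : i.+1%:R^-1 <= 1 :> R by rewrite invf_le1 ?ler1n.
  move: E up T1 T2 T3 i1 (uM i) (vM i).
  rewrite (metric_sym p (urep u i)) (metric_sym (urep u i) x).
  by clear; move: i.+1%:R^-1 => h; lra.
pose c (t : {i01 R}) : Y := umk (bg t).
have cgeo : is_geodesic c.
  by move=> s t; apply: mdist_umk_scale => i; rewrite (geoP (g i)).
exists (Geo cgeo); split => /=; last first.
  rewrite [RHS]umk_urep; apply: mdist_positivity; rewrite mdist_umk.
  apply: (slim_eq0 (bg _) (urep_bounded v)) => e /ltW e1.
  by apply: filterS filterT => i _ /=; rewrite (gP i).1 mdistxx mulr0.
rewrite [RHS]umk_urep; apply: mdist_positivity; rewrite mdist_umk.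
apply: (slim_eq0 (bg _) (urep_bounded u)) => e e00.
have [n ne] := exists_invS_lt e00.
apply: filterS (scale_cofinite l n) => i /= ni; rewrite metric_sym.
apply: le_trans (ltW (lg0 i)) _; apply: le_trans (ltW ne).
by rewrite lef_pV2 ?posrE// ler_nat.
Qed.

(** The ball of [X] has radius [n + 1] and that of the limit radius [n], which leaves room for
    approximating points slightly farther from the centre. *)
Definition ulim_approx (n : nat) (i : nat) := exists F : X -> Y,
  [/\ F x = ubase x l,
    forall a b, l i * mdist x a <= n.+1%:R -> l i * mdist x b <= n.+1%:R ->
      `|mdist (F a) (F b) - l i * mdist a b| <= n.+1%:R^-1 &
    forall z, mdist (ubase x l) z <= n%:R -> exists2 a, l i * mdist x a <= n.+1%:R &
      mdist (F a) z <= n.+1%:R^-1].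

(** Each point goes to the limit of a net point within [h / 3] of it; distances between net points
    agree with their limits up to [h / 3], so the distortion is at most [h]. *)
Lemma ulim_approx_near n : uniform_nets -> w (ulim_approx n).
Proof.
move=> nets; have n0 : 0 < n.+1%:R :> R by [].
pose h : R := n.+1%:R^-1; have h0 : 0 < h by rewrite invr_gt0.
have h1 : h <= 1 by rewrite invf_le1 ?ler1n.
have h3 : 0 < h / 3 by rewrite divr_gt0.
have [N [c [N0 c0 bc wc]]] := nets n.+1%:R (h / 3) n0 h3.
have wd : w [set i | forall j, (j <= N)%N -> forall k, (k <= N)%N ->
    `|mdist (umk (bc j)) (umk (bc k)) - l i * mdist (c j i) (c k i)| < h / 3].
  apply: filter_bounded_forall => j _; apply: filter_bounded_forall => k _.
  exact: mdist_umk_near.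
have c0E : umk (bc 0%N) = ubase x l.
  apply: mdist_positivity; rewrite mdist_umk c0; exact: slimxx (sbounded_cst x l).
apply: filterS (filterI wc wd) => i [/= cov dd].
have /choice[F FP] : forall a, exists v : Y, (a = x -> v = ubase x l) /\
    (l i * mdist x a <= n.+1%:R ->
      exists j, [/\ (j < N)%N, v = umk (bc j) & l i * mdist (c j i) a <= h / 3]).
  move=> a; have [->|ax] := pselect (a = x).
    exists (ubase x l); split => // _; exists 0%N; split => //.
    by rewrite c0 mdistxx mulr0 ltW.
  have [xa|xa] := pselect (l i * mdist x a <= n.+1%:R); last by exists (ubase x l).
  by have [j jN ja] := cov a xa; exists (umk (bc j)); split => // _; exists j.
exists F; split.
- by case: (FP x) => H _; exact: H.
- move=> a b xa xb; have [_ /(_ xa)[j [jN -> ja]]] := FP a.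
  have [_ /(_ xb)[k [kN -> kb]]] := FP b.
  have := dd j (ltnW jN) k (ltnW kN); rewrite -/h ltr_norml ler_norml.
  have T1 := sdist_triangle l i (c j i) a (c k i).
  have T2 := sdist_triangle l i a b (c k i).
  have T3 := sdist_triangle l i a (c j i) b.
  have T4 := sdist_triangle l i (c j i) (c k i) b.
  move: ja kb T1 T2 T3 T4; rewrite (metric_sym a (c j i)) (metric_sym b (c k i)).
  move: (mdist (umk _) _) => D; clear => ja kb T1 T2 T3 T4 /andP[d1 d2].
  by apply/andP; split; lra.
- move=> z oz; have [|j jN jz] := ulim_net_cover bc wc (v := z).
    by apply: le_lt_trans oz _; rewrite ltr_nat.
  have xc : l i * mdist x (c j i) <= n.+1%:R.
    have := dd 0%N (leq0n _) j (ltnW jN); rewrite c0E c0 ltr_norml => /andP[+ _].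
    have := metric_triangle (ubase x l) z (umk (bc j)).
    rewrite (metric_sym z) -(natr1 n) /=; move: oz jz h1; clear.
    by move: (n%:R : R) (mdist (ubase x l) z) => a b; lra.
  exists (c j i) => //; have [_ /(_ xc)[k [kN -> kj]]] := FP (c j i).
  have := dd k (ltnW kN) j (ltnW jN); rewrite -/h ltr_norml => /andP[_].
  have := metric_triangle (umk (bc k)) (umk (bc j)) z.
  by move: kj jz; clear; lra.
Qed.

Lemma geodesic_point (o v : Y) (t : R) : geodesic_space Y -> 0 <= t <= 1 ->
  exists z : Y, mdist o z = t * mdist o v /\ mdist v z = (1 - t) * mdist o v.
Proof.
move=> gY /andP[t0 t1]; have [g [<- <-]] := gY o v.
exists (g (Itv01 t0 t1)); split.
  by rewrite (geoP g) /= sub0r normrN ger0_norm.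
by rewrite (geoP g) /= ger0_norm// subr_ge0.
Qed.

(** [F] respects the closed balls of radius [r] only up to its error [h]; moving points along
    geodesics from the base point corrects this at the cost of a few more [h]. *)
Lemma ulim_approx_quasi_isometry (n i : nat) (r : R) : geodesic_space Y ->
  0 < r <= n%:R -> ulim_approx n i ->
  exists f : X -> Y, quasi_isometry (fun a b => l i * mdist a b) (@mdist R Y)
    (closed_dball (fun a b => l i * mdist a b) x r)
    (closed_dball (@mdist R Y) (ubase x l) r) (5 * n.+1%:R^-1) f /\
    f x = ubase x l.
Proof.
move=> gY /andP[r0 rn] [F [Fx Fi Fs]].
have rn1 : r <= n.+1%:R by apply: le_trans rn _; rewrite ler_nat.
pose o := ubase x l.
have h0 : 0 < n.+1%:R^-1 :> R by rewrite invr_gt0.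
move: (n.+1%:R^-1) h0 Fi Fs => h h0 Fi Fs.
have ol a : l i * mdist x a <= n.+1%:R -> `|mdist o (F a) - l i * mdist x a| <= h.
  move=> xa; have := Fi x a; rewrite Fx mdistxx mulr0; apply => //.
(* pull the image back into the ball of radius [r] along a geodesic from [o] *)
have /choice[f fP] : forall a, exists v : Y, (a = x -> v = o) /\
    (l i * mdist x a <= r -> mdist o v <= r /\ mdist (F a) v <= h).
  move=> a; have [xa|xa] := pselect (l i * mdist x a <= r); last by exists o.
  have oF : mdist o (F a) <= r + h.
    by have := ol a (le_trans xa rn1); rewrite ler_norml => /andP[_]; move: xa; clear; lra.
  have rh : 0 < r + h by lra.
  have [|z [oz Fz]] := @geodesic_point o (F a) (r / (r + h)) gY.
    apply/andP; split; first by rewrite divr_ge0 ?ltW.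
    by rewrite ler_pdivrMr// mul1r lerDl ltW.
  exists z; split=> [ax|_]; first by apply/esym/mdist_positivity; rewrite oz ax Fx mdistxx mulr0.
  split.
    by rewrite oz mulrAC ler_pdivrMr// ler_pM2l.
  rewrite Fz (_ : 1 - r / (r + h) = h / (r + h)).
    by rewrite mulrAC ler_pdivrMr// ler_pM2l.
  by field; rewrite gt_eqF.
exists f; split; [split|].
- by move=> a /= xa; exact: ((fP a).2 xa).1.
- move=> a b xa xb; have [_ Fa] := (fP a).2 xa; have [_ Fb] := (fP b).2 xb.
  have := Fi a b (le_trans xa rn1) (le_trans xb rn1).
  have := metric_triangle (f a) (F a) (f b); have := metric_triangle (F a) (F b) (f b).
  have := metric_triangle (F a) (f a) (F b); have := metric_triangle (f a) (f b) (F b).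
  rewrite (metric_sym (f a) (F a)) (metric_sym (f b) (F b)) !ler_norml.
  by move: Fa Fb h0; clear => Fa Fb h0 T1 T2 T3 T4 /andP[d1 d2]; apply/andP; split; lra.
- move=> z oz; rewrite /closed_dball/= in oz.
  have [r2|r2] := leP r (2 * h).
    exists x; first by rewrite /closed_dball/= mdistxx mulr0 ltW.
    have xr : l i * mdist x x <= r by rewrite mdistxx mulr0 ltW.
    have [_ Fxf] := (fP x).2 xr; rewrite Fx in Fxf.
    have := metric_triangle (f x) o z; rewrite (metric_sym (f x) o).
    by move: Fxf oz r2 h0; rewrite -/o; clear; lra.
  (* [z] is moved inward by at most [2 * h], so that a point whose image is [h]-close to [z'] lies
     in the ball of radius [r]. *)
  have [|z' [oz' zz']] := @geodesic_point o z ((r - 2 * h) / r) gY.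
    apply/andP; split; first by rewrite divr_ge0 ?ltW ?subr_gt0.
    by rewrite ler_pdivrMr// mul1r; move: h0; clear; lra.
  have oz'r : mdist o z' <= r - 2 * h.
    by rewrite oz' mulrAC ler_pdivrMr// ler_pM2l ?subr_gt0.
  have zz'h : mdist z z' <= 2 * h.
    rewrite zz' (_ : 1 - (r - 2 * h) / r = 2 * h / r).
      by rewrite mulrAC ler_pdivrMr// ler_pM2l// mulr_gt0.
    by field; rewrite gt_eqF.
  have [|a xa az'] := Fs z'.
    by move: oz'r rn h0; rewrite /o; clear; lra.
  have xar : l i * mdist x a <= r.
    have := ol a xa; rewrite ler_norml => /andP[+ _].
    have := metric_triangle o z' (F a); rewrite (metric_sym z' (F a)).
    by move: oz'r az'; clear; lra.
  exists a => //; have [_ Fa] := (fP a).2 xar.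
  have := metric_triangle (f a) (F a) z; have := metric_triangle (F a) z' z.
  rewrite (metric_sym (f a) (F a)) (metric_sym z' z).
  by move: Fa az' zz'h h0; clear; lra.
- exact: (fP x).1.
Qed.

Lemma ulim_pGH : uniform_nets -> geodesic_space Y -> exists k : nat -> nat,
  (forall n, (n <= k n)%N) /\
  pGH_cvg (T := fun=> X) (fun i a b => l (k i) * mdist a b) (fun=> x)
    (@mdist R Y) (ubase x l).
Proof.
move=> nets gY.
have /choice[k kP] : forall n, exists k, (n <= k)%N /\ ulim_approx n k.
  move=> n; have [k [/= nk ak]] :=
    filter_ex (filterI (scale_cofinite l n) (ulim_approx_near n nets)).
  by exists k.
exists k; split=> [n|r r0]; first by case: (kP n).
(* For the finitely many [n] below [r] a constant map with error [2 * r] serves, as a map is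
   required at every index. *)
pose e (n : nat) : R := if r <= n%:R then 5 * n.+1%:R^-1 else 2 * r.
have /choice[f fP] : forall n, exists f : X -> Y,
    quasi_isometry (fun a b => l (k n) * mdist a b) (@mdist R Y)
    (closed_dball (fun a b => l (k n) * mdist a b) x r)
    (closed_dball (@mdist R Y) (ubase x l) r) (e n) f /\ f x = ubase x l.
  move=> n; rewrite /e; have [rn|nr] := leP r n%:R.
    by apply: ulim_approx_quasi_isometry => //; [rewrite r0|exact: (kP n).2].
  exists (cst (ubase x l)); split => //; split.
  - by move=> a _; rewrite /closed_dball/= mdistxx ltW.
  - move=> a b xa xb; rewrite /= mdistxx sub0r normrN ger0_norm ?sdist_ge0//.
    have := sdist_triangle l (k n) a x b; rewrite (metric_sym a x).
    by move: xa xb; rewrite /closed_dball/=; clear; lra.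
  - move=> z oz; exists x; first by rewrite /closed_dball/= mdistxx mulr0 ltW.
    by move: oz r0; rewrite /closed_dball/=; clear; lra.
exists e, (fun n => f n); split => //.
apply/cvgrPdist_lt => h h0.
have [n1 n1h] := exists_invS_lt (ltac:(lra) : 0 < h / 5).
exists (maxn n1 (Num.bound r)) => // n /=; rewrite geq_max => /andP[n1n rn].
have -> : e n = 5 * n.+1%:R^-1.
  rewrite /e ifT//; apply: le_trans (ltW (archi_boundP (ltW r0))) _.
  by rewrite ler_nat.
rewrite sub0r normrN ger0_norm ?mulr_ge0 ?invr_ge0//.
have : n.+1%:R^-1 <= n1.+1%:R^-1 :> R by rewrite lef_pV2 ?posrE// ler_nat.
by move: n1h; clear; move: (n.+1%:R^-1 : R) (n1.+1%:R^-1 : R) => a b; lra.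
Qed.

End ultralimit_compactness.

(** * Uniqueness of the tangent *)

Section doubling.
Context {R : realType} {X : completeMetricType R}.

Lemma size_flatten_map_le (T : eqType) (S : Type) (f : T -> seq S) (s : seq T) C :
  (forall z, z \in s -> (size (f z) <= C)%N) ->
  (size (flatten (map f s)) <= size s * C)%N.
Proof.
elim: s => [//|a s IH] H /=; rewrite size_cat mulSn leq_add//.
  by apply: H; rewrite mem_head.
by apply: IH => z zs; apply: H; rewrite in_cons zs orbT.
Qed.

(** Doubling is iterated [k] times. Centres at distance [2 * r] or more are dropped: the others
    suffice to cover the ball and stay in the neighbourhood where doubling holds. *)
Lemma doubling_cover (x : X) : locally_doubling X ->
  exists r1 : R, 0 < r1 /\ exists C : nat, forall (k : nat) (r : R), 0 < r <= r1 ->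
  exists s : seq X, [/\ (size s <= C ^ k)%N,
    forall z, z \in s -> mdist x z < 2 * r &
    forall y, mdist x y < r -> exists2 z, z \in s & mdist z y < r / 2 ^+ k].
Proof.
move=> /(_ x)[U /nbhs_mdist_exP[e e0 eU] [r0 [C [r00 HC]]]].
have [r1 [r10 r1e r1r0]] : exists r1 : R, [/\ 0 < r1, 2 * r1 <= e & r1 <= r0].
  exists (Num.min (e / 2) r0); split.
  - by rewrite lt_min r00 divr_gt0.
  - have : Num.min (e / 2) r0 <= e / 2 by rewrite ge_min lexx.
    by clear; lra.
  - by rewrite ge_min lexx orbT.
exists r1; split => //; exists C => k r /andP[r_gt0 rr1].
have p2 n : 1 <= 2 ^+ n :> R by apply: exprn_ege1; rewrite ler1n.
have p2' n : 0 < 2 ^+ n :> R by rewrite exprn_gt0.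
elim: k => [|k [s [sC sx scov]]].
  exists [:: x]; split => // [z|y xy].
    by rewrite inE => /eqP ->; rewrite mdistxx mulr_gt0.
  by exists x; rewrite ?inE// expr0 divr1.
have rk0 : 0 < r / 2 ^+ k by rewrite divr_gt0.
have rkr : r / 2 ^+ k <= r by rewrite ler_pdivrMr// ler_peMr// ltW.
have /choice[f fP] : forall z, exists t : seq X, z \in s -> (size t <= C)%N /\
    forall y, mdist z y < r / 2 ^+ k -> exists2 v, v \in t & mdist v y < r / 2 ^+ k.+1.
  move=> z; have [zs|] := boolP (z \in s); last by exists [::].
  have Uz : U z by apply: eU; apply: lt_le_trans (sx _ zs) _; lra.
  have [|t tC tcov] := HC z (r / 2 ^+ k) Uz; first by apply/andP; split => //; lra.
  exists t => _; split => // y zy; have [|v vt] := tcov y; first by rewrite ballEmdist.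
  by rewrite ballEmdist/= => vy; exists v => //; rewrite exprSr invfM mulrA.
exists [seq v <- flatten (map f s) | `[< mdist x v < 2 * r >]]; split.
- rewrite size_filter (leq_trans (count_size _ _))// expnSr.
  apply: leq_trans (leq_mul sC (leqnn C)); apply: size_flatten_map_le => z zs.
  exact: (fP z zs).1.
- by move=> z; rewrite mem_filter => /andP[/asboolP].
- move=> y xy; have [z zs zy] := scov y xy.
  have [v vf vy] := (fP z zs).2 y zy; exists v => //.
  rewrite mem_filter; apply/andP; split; last by apply/flatten_mapP; exists z.
  apply/asboolP; have := metric_triangle x y v; rewrite (metric_sym y).
  have : r / 2 ^+ k.+1 <= r by rewrite ler_pdivrMr// ler_peMr// ltW.
  by move: xy vy; clear; lra.
Qed.

Lemma doubling_nets (x : X) (l : scaling R) : locally_doubling X ->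
  l @ \oo --> +oo -> uniform_nets x l.
Proof.
(* The radius [r + 1] puts the closed ball of radius [r] inside an open one. *)
move=> /(doubling_cover x)[r1 [r10 [C cov]]] loo r e r_gt0 e0.
pose r' := r + 1; have r'0 : 0 < r' by rewrite addr_gt0.
have [k rk] : exists k, r' / 2 ^+ k <= e.
  have [n ne] := exists_invS_lt (divr_gt0 e0 r'0).
  exists n; rewrite mulrC -ler_pdivlMr//; apply: le_trans (ltW ne).
  rewrite lef_pV2 ?posrE ?exprn_gt0//.
  by rewrite -natrX ler_nat ltn_expl.
have wP : ProperFilter (scale_filter l) := @ultra_proper _ _ (scale_ultra l).
have lw : scale_filter l [set i | r' / r1 <= l i].
  have /cvgryPge/(_ (r' / r1))[N _ HN] := loo.
  by apply: filterS (scale_cofinite l N) => i Ni; exact: HN.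
have /choice[s sP] : forall i, exists s : seq X,
    [/\ (size s <= C ^ k)%N, forall z, z \in s -> l i * mdist x z <= 2 * r' &
     r' / r1 <= l i -> forall y, l i * mdist x y <= r ->
       exists2 z, z \in s & l i * mdist z y <= e].
  move=> i; have [li|li] := pselect (r' / r1 <= l i); last by exists [::].
  have l0 := scale_gt0 l i.
  have [|t [tC tx tcov]] := cov k (r' / l i).
    rewrite divr_gt0//= ler_pdivrMr// mulrC -ler_pdivrMr//.
  exists t; split => // [z /tx|_ y xy].
    by rewrite mulrA ltr_pdivlMr// mulrC => /ltW.
  have [|z zt zy] := tcov y.
    by rewrite ltr_pdivlMr// mulrC; apply: le_lt_trans xy _; rewrite ltrDl.
  exists z => //; apply: le_trans rk; move: zy.
  by rewrite mulrAC ltr_pdivlMr// mulrC => /ltW.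
(* Index 0 is reserved for the base point, which also fills the places after the end of the list
   [s i]. *)
exists (C ^ k).+1, (fun j i => if j is j'.+1 then nth x (s i) j' else x); split => //.
- move=> j; exists (2 * r') => i; case: j => [|j].
    by rewrite mdistxx mulr0 mulr_ge0// ltW.
  have [jS|Sj] := ltnP j (size (s i)).
    by have [_ H _] := sP i; apply: H; exact: mem_nth.
  by rewrite nth_default// mdistxx mulr0 mulr_ge0// ltW.
- apply: filterS lw => i li y xy; have [sC _ /(_ li y xy)[z zs zy]] := sP i.
  exists (index z (s i)).+1; last by rewrite nth_index.
  by rewrite ltnS (leq_trans _ sC)// index_mem.
Qed.

(** If it failed at scales [r n] tending to 0, the ultralimit of [X] rescaled by [(r n)^-1] would be
    a tangent, hence the line, and the resulting approximations would make some scale [r (k N)]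
    line-like. *)
Lemma tangent_line_like (x : X) (e : R) : 0 < e -> locally_doubling X ->
  (forall a p (e : R), 0 < e -> exists2 q, mdist a q < e &
     exists g : geo X, g 0%:i01 = q /\ g 1%:i01 = p) ->
  (forall (Y : completeMetricType R) (y : Y),
    in_Tan x y -> pointed_isometric y (0 : R^o)) ->
  exists2 r0 : R, 0 < r0 & forall r, 0 < r < r0 -> line_like x e r.
Proof.
move=> e0 dX dg tan; apply: contrapT => nex.
have /choice[r rP] : forall n : nat, exists r : R,
    0 < r < n.+1%:R^-1 /\ ~ line_like x e r.
  move=> n; apply: contrapT => H; apply: nex; exists (n.+1%:R^-1) => [|r rn].
    by rewrite invr_gt0.
  by apply: contrapT => nl; apply: H; exists r.
have r0 n : 0 < r n by have [/andP[]] := rP n.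
have [w [wU wF]] := ultraFilterLemma eventually_filter.
have l0 i : 0 < (r i)^-1 by rewrite invr_gt0.
have wc n : w [set i | (n <= i)%N] by apply: wF; exists n.
have [l lr] : exists l : scaling R, forall n, l n = (r n)^-1.
  by exists (Scaling l0 wU wc).
have lge n : n%:R <= l n.
  have [/andP[_ rn] _] := rP n; apply: (@le_trans _ _ n.+1%:R).
    by rewrite ler_nat.
  by rewrite lr -[leLHS]invrK lef_pV2 ?posrE ?invr_gt0// ltW.
have cvg_oo (k : nat -> nat) : (forall n, (n <= k n)%N) -> l \o k @ \oo --> +oo.
  move=> kn; apply/cvgryPge => A; exists (Num.bound `|A|) => // n /= An.
  apply: le_trans (lge _); apply: le_trans (ler_norm _) _.
  apply: le_trans (ltW (archi_boundP (normr_ge0 _))) _.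
  by rewrite ler_nat (leq_trans An).
have loo : l @ \oo --> +oo by exact: (cvg_oo id).
have nets := doubling_nets x dX loo.
have gY := ulim_geodesic_space dg (x := x) (l := l).
have [k [kn pgh]] := ulim_pGH nets gY.
have [h [[h' hK h'K] hi h0]] : pointed_isometric (ubase x l) (0 : R^o).
  apply: tan; split => //.
  - exact: ulim_separable.
  - exact: ulim_locally_compact.
  exists (l \o k); split => //.
  - by move=> i; exact: scale_gt0.
  - exact: cvg_oo.
(* The unit ball at index [N] is the ball of radius [r (k N)] in [X]. *)
have [e' [f [e'0 fP]]] := pgh 1 ltr01.
have [N _ HN] := (cvgrPdist_lt _ _).1 e'0 e e0.
have := HN N (leqnn _); rewrite /= sub0r normrN => e'N.
have {e'N}e'N : e' N <= e by apply: le_trans (ler_norm _) (ltW e'N).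
have [[fB fI fD] fx] := fP N.
have := (rP (k N)).2; apply.
have rk0 := r0 (k N).
have lE := lr (k N).
move: (r (k N)) rk0 lE => t t0 lE.
have B p : mdist x p <= t -> closed_dball (fun a b => l (k N) * mdist a b) x 1 p.
  by move=> xp; rewrite /closed_dball/= lE mulrC ler_pdivrMr// mul1r.
have hE a b : mdist a b = `|(h a : R) - h b| by rewrite -hi distrC.
have et : e' N * t <= e * t by rewrite ler_pM2r.
exists (fun p => t * (h (f N p) : R)); split.
- by rewrite fx h0 mulr0.
- move=> p q xp xq; apply: le_trans et; have := fI p q (B p xp) (B q xq).
  rewrite -mulrBr normrM (gtr0_norm t0) lE -hE => H.
  have -> : mdist p q = t * (t^-1 * mdist p q) by rewrite mulrA divff ?mul1r// gt_eqF.
  by rewrite -mulrBr normrM (gtr0_norm t0) mulrC ler_pM2r.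
- move=> s st; have [|p Bp fp] := fD (h' (s / t)).
    rewrite /closed_dball/= hE h'K h0 sub0r normrN normrM normfV (gtr0_norm t0).
    by rewrite ler_pdivrMr// mul1r.
  exists p.
    by move: Bp; rewrite /closed_dball/= lE mulrC ler_pdivrMr// mul1r.
  apply: le_trans et; move: fp; rewrite hE h'K => fp.
  have -> : t * (h (f N p) : R) - s = t * ((h (f N p) : R) - s / t).
    by rewrite mulrBr mulrCA divff ?mulr1// gt_eqF.
  by rewrite normrM (gtr0_norm t0) mulrC ler_pM2r.
Qed.

End doubling.

(** * Charts at funnel points and conclusion *)

Lemma funnel_coordinate (R : realType) (X : completeMetricType R) (z : X) :
  length_space X -> locally_compact [set: X] ->
  (forall (A : set X) p q, open A -> A !=set0 ->
    (forall a, A a -> mdist a p = mdist a q) -> p = q) ->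
  funnel z -> exists c d, [/\ 0 < d,
    forall p q, mdist z p < d -> mdist z q < d ->
      mdist p q = `|mdist p c - mdist q c| &
    forall p (t : R), mdist z p < d -> mdist z c - d < t <= mdist p c ->
      exists2 q, mdist z q < d & mdist q c = t].
Proof.
move=> lX cX eqd [c [A [U [zc oA A0 zU AU]]]].
have [|d /andP[d0 _] [iso onto]] := radial_coordinate lX cX zU zc.
  move=> p q Up Uq pq; apply: (eqd A) => // a Aa.
  by rewrite (AU a p)// (AU a q)// !(metric_sym c) pq.
by exists c, d.
Qed.

Theorem theorem3p10 (R : realType) (X : completeMetricType R)
    (m : {measure set (borel X) -> \bar R})
    (X_locally_compact : locally_compact [set: X])
    (X_separable : separable X)
    (X_length : length_space X)
    (m_locally_finite : locally_finite_measure m)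
    (m_support : measure_support m = [set: X])
    (X_doubling : locally_doubling X)
    (transport_maps : forall mu0 mu1 : probability (borel X) R,
       P2ac m mu0 -> P2 mu1 ->
       exists p : probability (borel (geo X)) R,
         [/\ OptGeo mu0 mu1 p,
             forall p' : probability (borel (geo X)) R,
               OptGeo mu0 mu1 p' -> measure_eq p' p
           & induced_by_map mu0 p])
    (line_tangent : exists x : X, Tan_eq_line x) :
  one_manifold_with_boundary R X.
Proof.
have dg := geodesic_of_ac m_locally_finite m_support transport_maps.
have eqd := equidistant_eq m_locally_finite m_support transport_maps.
have coord z := @funnel_coordinate R X z X_length X_locally_compact eqd.
have [x [_ tan]] := line_tangent.
have e0 : 0 < 1000^-1 :> R by rewrite invr_gt0 ltr0n.
have [r0 r00 line] := tangent_line_like e0 X_doubling dg tan.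
have [z1 fz1] := line_like_funnel r00 line dg.
have [c1 [d1 [d10 iso1 onto1]]] := coord _ fz1.
have [z0 [psi I]] := interval_ball_of_coordinate d10 iso1 onto1.
split; [exact: metric_hausdorff|exact: second_countable_separable|] => z.
(* The one interval ball around [z0] makes every [z] a funnel point. *)
have [|c [d [d0 iso onto]]] := coord z.
  by apply: (interval_ball_funnel z X_length _ I); rewrite divr_gt0.
exact: radial_chart d0 iso onto.
Qed.
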